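(* $Sp(\mathbf{BA})=Sp_c(\mathbf{CP}_0)$; that is, a set of Turing degrees is the degree spectrum of some countable Boolean algebra if and only if it is the compact degree spectrum of some compact zero-dimensional Polish space.
   Context: The degree spectrum of a countable Boolean algebra $B$ is the set of Turing degrees $\mathbf{d}$ such that $B$ is isomorphic to a Boolean algebra whose universe is a subset of $\omega$ and whose operations are $\mathbf{d}$-computable. A Polish presentation of a Polish space $X$ is a metric $d$ on $\omega$ whose Cauchy completion is homeomorphic to $X$; let $a_i$ be the point corresponding to $i$; it is $\mathbf{d}$-computable if the reals $d(i,j)$ are uniformly $\mathbf{d}$-computable. For compact $X$, a code of a finite rational open cover is a finite $E\subseteq\omega\times\mathbb{Q}$ such that every $x\in X$ satisfies $d(x,a_i)<r$ for some $(i,r)\in E$. A compact presentation is a Polish presentation together with an enumeration of the set of all such codes; it is $\mathbf{d}$-computable if the metric is $\mathbf{d}$-computable and the set of codes is $\mathbf{d}$-c.e. The compact degree spectrum of $X$ is the set of $\mathbf{d}$ such that $X$ has a $\mathbf{d}$-computable compact presentation. $Sp(\mathbf{BA})$ is the class of degree spectra of countable Boolean algebras and $Sp_c(\mathbf{CP}_0)$ is the class of compact degree spectra of compact zero-dimensional Polish spaces.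
   Formalization: For finite spaces a Polish presentation may be a pseudometric on ω (a metric on ω cannot present them), and the compact zero-dimensional spaces are taken nonempty; otherwise their compact spectra would be empty and the equality false. Universes of computable copies are d-computable. *)

(* Defs.v *)
From HB Require Import structures.
From mathcomp Require Import all_boot all_order all_algebra.
From mathcomp Require Import all_classical all_reals all_analysis.

Set Implicit Arguments.
Unset Strict Implicit.
Unset Printing Implicit Defensive.

Import Order.TTheory GRing.Theory Num.Theory.
Import numFieldNormedType.Exports.

Local Open Scope classical_set_scope.
Local Open Scope ring_scope.

(** * Relative computability and Turing degrees *)

(* The total functions recursive in the oracle A: the least class containing
   zero, successor, the projections and the characteristic function of A, and
   closed under composition, primitive recursion and minimization of regular
   functions.  The defined function [h] is given by its equations, which
   determine it, so the class is closed under extensional equality. *)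
Inductive recursive_in (A : nat -> bool) :
    forall n : nat, (n.-tuple nat -> nat) -> Prop :=
| rec_zero n : recursive_in A (fun _ : n.-tuple nat => 0%N)
| rec_succ : recursive_in A (fun v : 1.-tuple nat => (thead v).+1)
| rec_proj n (i : 'I_n) : recursive_in A (fun v : n.-tuple nat => tnth v i)
| rec_oracle : recursive_in A (fun v : 1.-tuple nat => nat_of_bool (A (thead v)))
| rec_comp m n (f : m.-tuple nat -> nat) (g : 'I_m -> n.-tuple nat -> nat)
    (h : n.-tuple nat -> nat) :
    recursive_in A f -> (forall i, recursive_in A (g i)) ->
    (forall v, h v = f [tuple g i v | i < m]) ->
    recursive_in A h
| rec_prim n (f : n.-tuple nat -> nat) (g : n.+2.-tuple nat -> nat)
    (h : n.+1.-tuple nat -> nat) :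
    recursive_in A f -> recursive_in A g ->
    (forall v : n.-tuple nat, h [tuple of 0%N :: v] = f v) ->
    (forall k (v : n.-tuple nat),
       h [tuple of k.+1 :: v] = g [tuple of k :: h [tuple of k :: v] :: v]) ->
    recursive_in A h
| rec_min n (f : n.+1.-tuple nat -> nat) (h : n.-tuple nat -> nat) :
    recursive_in A f ->
    (forall v : n.-tuple nat, f [tuple of h v :: v] = 0%N /\
       forall k, (k < h v)%N -> f [tuple of k :: v] <> 0%N) ->
    recursive_in A h.

Definition unary (f : nat -> nat) (v : 1.-tuple nat) : nat := f (thead v).

Definition binary (f : nat -> nat -> nat) (v : 2.-tuple nat) : nat :=
  f (tnth v ord0) (tnth v ord_max).

Definition turing_le (A B : nat -> bool) : Prop :=
  recursive_in B (unary (fun n => nat_of_bool (A n))).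

Definition turing_equiv (A B : nat -> bool) : Prop :=
  turing_le A B /\ turing_le B A.

Record turing_degree := TuringDegree {
  degree_class :> set (nat -> bool) ;
  degree_classP : exists A, degree_class = [set B | turing_equiv A B] }.

Definition computable (d : turing_degree) n (f : n.-tuple nat -> nat) : Prop :=
  exists2 A, degree_class d A & recursive_in A f.

Definition computable_set (d : turing_degree) (U : nat -> bool) : Prop :=
  computable d (unary (fun n => nat_of_bool (U n))).

Definition computably_enumerable (d : turing_degree) (W : set nat) : Prop :=
  W = set0 \/ exists2 f : nat -> nat, computable d (unary f) & W = range f.

(** * Degree spectra of Boolean algebras *)

(* [h] is an isomorphism of B onto a structure with universe U and operations
   [meet], [join], [compl]; as usual for a d-computable structure, the universe
   is d-computable too.  The values of the operations outside U are irrelevant. *)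
Definition has_computable_copy (disp : Order.disp_t)
    (B : ctbDistrLatticeType disp) (d : turing_degree) : Prop :=
  exists (U : nat -> bool) (meet join : nat -> nat -> nat) (compl : nat -> nat)
         (h : B -> nat),
    [/\ [/\ computable_set d U, computable d (binary meet),
            computable d (binary join) & computable d (unary compl)],
        injective h /\ range h = [set n | U n],
        forall x y : B, h (Order.meet x y) = meet (h x) (h y),
        forall x y : B, h (Order.join x y) = join (h x) (h y)
      & forall x : B, h (Order.compl x) = compl (h x)].

Definition degree_spectrum (disp : Order.disp_t)
    (B : ctbDistrLatticeType disp) : set turing_degree :=
  [set d | has_computable_copy B d].

Definition Sp_BA : set (set turing_degree) :=
  [set S | exists (disp : Order.disp_t) (B : ctbDistrLatticeType disp),
     countable [set: B] /\ S = degree_spectrum B].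

(** * Compact zero-dimensional Polish spaces *)

Definition homeomorphic (X Y : topologicalType) : Prop :=
  exists (f : X -> Y) (g : Y -> X),
    [/\ cancel f g, cancel g f, continuous f & continuous g].

Definition complete_metric (R : realType) (M : metricType R) : Prop :=
  forall u : nat -> M, cauchy (u @ \oo) -> exists l : M, u @ \oo --> l.

Definition separable_space (X : topologicalType) : Prop :=
  exists2 D : set X, countable D & dense D.

Definition polish_space (R : realType) (X : topologicalType) : Prop :=
  separable_space X /\
  exists2 M : metricType R, complete_metric M & homeomorphic M X.

(* The library's [zero_dimensional] only asks that points be separated by
   clopen sets. *)
Definition clopen_basis (X : topologicalType) : Prop :=
  exists2 B : set (set X), basis B & B `<=` clopen.

(* A space presented by a metric on nat is nonempty. *)
Definition CP0 (R : realType) (X : topologicalType) : Prop :=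
  [/\ [set: X] !=set0, compact [set: X], clopen_basis X & polish_space R X].

(** * Polish and compact presentations *)

Definition pseudometric_on_nat (R : realType) (rho : nat -> nat -> R) : Prop :=
  [/\ forall i, rho i i = 0,
      forall i j, rho i j = rho j i
    & forall i j k, rho i k <= rho i j + rho j k].

Definition metric_on_nat (R : realType) (rho : nat -> nat -> R) : Prop :=
  pseudometric_on_nat rho /\ forall i j, rho i j = 0 -> i = j.

Definition is_cauchy_completion (R : realType) (rho : nat -> nat -> R)
    (M : metricType R) (a : nat -> M) : Prop :=
  [/\ complete_metric M, dense (range a)
    & forall i j, mdist (a i) (a j) = rho i j].

(* The completion of an infinite metric space is infinite, so a genuine metric
   on nat cannot present a finite space; repetitions among the points [a i] are
   allowed for finite X, and only then. *)
Definition polish_presentation (R : realType) (X : topologicalType)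
    (rho : nat -> nat -> R) (M : metricType R) (a : nat -> M) : Prop :=
  [/\ pseudometric_on_nat rho,
      infinite_set [set: X] -> metric_on_nat rho,
      is_cauchy_completion rho a
    & homeomorphic M X].

(* The rational (p - q) / (s + 1) approximates rho i j to within 2^-k. *)
Definition computable_metric (R : realType) (d : turing_degree)
    (rho : nat -> nat -> R) : Prop :=
  exists p q s : 3.-tuple nat -> nat,
    [/\ computable d p, computable d q, computable d s
      & forall i j k : nat, let v := [tuple i; j; k] in
          `| rho i j - ((p v)%:R - (q v)%:R) / (s v).+1%:R | <= 2^-1 ^+ k].

(* Goedel numbering of nat * rat and of its finite subsets, through the
   bijection [CodeSeq.decode] between nat and [seq nat]; both numberings are
   onto.  A finite set is represented by a list of its elements. *)
Definition ball_of_code (n : nat) : nat * rat :=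
  let s := CodeSeq.decode n in
  (nth 0%N s 0,
   ((nth 0%N s 1)%:R - (nth 0%N s 2)%:R) / (nth 0%N s 3).+1%:R).

Definition finset_of_code (n : nat) : seq (nat * rat) :=
  map ball_of_code (CodeSeq.decode n).

Definition covers (R : realType) (M : metricType R) (a : nat -> M)
    (E : seq (nat * rat)) : Prop :=
  forall x : M, exists2 b, b \in E & mdist x (a b.1) < ratr b.2.

Definition cover_codes (R : realType) (M : metricType R) (a : nat -> M) :
    set nat :=
  [set n | covers a (finset_of_code n)].

Definition has_computable_compact_presentation (R : realType)
    (X : topologicalType) (d : turing_degree) : Prop :=
  exists (rho : nat -> nat -> R) (M : metricType R) (a : nat -> M),
    [/\ polish_presentation X rho a, computable_metric d rho
      & computably_enumerable d (cover_codes a)].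

Definition compact_degree_spectrum (R : realType) (X : topologicalType) :
    set turing_degree :=
  [set d | has_computable_compact_presentation R X d].

Definition Sp_c_CP0 (R : realType) : set (set turing_degree) :=
  [set S | exists X : topologicalType,
     CP0 R X /\ S = compact_degree_spectrum R X].

(* Main.v *)
Require Import Defs.
From HB Require Import structures.
From mathcomp Require Import all_boot all_order all_algebra.
From mathcomp Require Import all_classical all_reals all_analysis.
From mathcomp Require Import zify ring lra.

Set Implicit Arguments.
Unset Strict Implicit.
Unset Printing Implicit Defensive.

Import Order.Theory GRing.Theory Num.Theory.
Import numFieldNormedType.Exports.

Local Open Scope classical_set_scope.

(** Stone duality makes a countable Boolean algebra [B] and its space [X] of
    ultrafilters determine each other, and both passages are effective relative to
    any oracle.  An enumeration [b] of [B] turns [X] into the space of the sequences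
    [x : nat -> bool] all of whose finite meets of [b i] or [~` b i] (as [x i] tells)
    are nonzero, with the metric of the first difference.  From a computable copy of
    [B] one computes a dense sequence of branches by following the bits of a number
    greedily; balls are cylinders, so that covering is decidable.  Conversely, in a
    compact presentation a clopen set is coded by two finite lists of balls which
    cover the space together and are formally disjoint, with witnesses for both
    facts.  For such codes the relation [C_i & C_l <= C_j | C_k] is decidable: if it
    holds then certain balls cover the space, and otherwise some point of the dense
    sequence refutes it.  The operations are then found by unbounded search. *)

(** * Recursive functions of nested pairs *)

(** Both inclusions rest on one comparison, [dual_spectrum], for any algebra and space related by
    [stone_dual]; it is applied to [B] with its branches and to [X] with its own clopen sets. The
    isomorphisms and homeomorphisms involved need not be computable: only the copies and
    presentations are. Three obstacles shape the details. The one-element algebra has no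
    ultrafilter, whereas a presented space has points; every degree computes a copy of it, so the
    two-element algebra can replace it. A presentation of an infinite space needs distinct points,
    so repetitions among the greedy branches have to be detected; this is decidable because an index
    has finitely many nonzero digits, after which the meet already reached determines the rest. In
    the other direction distances are only approximated and covers only enumerated, so a clopen set
    has to carry a code of its complement. Inclusions with two sets on each side then have
    enumerable conditions for truth and for falsity, and they express the graphs of meet, join and
    complement before any of these operations is known to be computable. *)

Fixpoint ctx (n : nat) : Type :=
  if n is n'.+1 then (nat * ctx n')%type else unit.

Fixpoint mkctx (n : nat) (s : nat -> nat) : ctx n :=
  match n return ctx n with
  | 0 => tt
  | n'.+1 => (s 0%N, mkctx n' (fun i => s i.+1))
  end.

(* Arguments as nested pairs rather than tuples: under a binder the context [v]
   becomes [(k, v)], whose projections compute. *)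
Definition Rec (A : nat -> bool) n (f : ctx n -> nat) : Prop :=
  recursive_in A (fun v : n.-tuple nat => f (mkctx n (nth 0%N v))).

Fixpoint prec (x : nat) (g : nat -> nat -> nat) (k : nat) : nat :=
  if k is k'.+1 then g k' (prec x g k') else x.

(** Search is made total by a classical case distinction, so that terms can be written before a
    witness is known; [Rec_mu] asks for a witness at every argument, as regular minimization
    does. *)
Definition mu (P : nat -> bool) : nat :=
  match pselect (exists n, P n) with
  | left e => ex_minn e
  | right _ => 0%N
  end.

Lemma muP (P : nat -> bool) : (exists n, P n) ->
  P (mu P) /\ forall k, P k -> (mu P <= k)%N.
Proof. by rewrite /mu; case: pselect => // e _; case: ex_minnP. Qed.

Definition ballb (n : nat) (P : nat -> bool) : bool := all P (iota 0 n).
Definition bexb (n : nat) (P : nat -> bool) : bool := has P (iota 0 n).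

Lemma ballbP n (P : nat -> bool) : reflect (forall k, (k < n)%N -> P k) (ballb n P).
Proof.
apply: (iffP allP) => h k; first by move=> kn; apply: h; rewrite mem_iota.
by rewrite mem_iota => /h.
Qed.

Lemma bexbP n (P : nat -> bool) : reflect (exists2 k, (k < n)%N & P k) (bexb n P).
Proof.
apply: (iffP hasP) => -[k kn Pk]; exists k => //; last by rewrite mem_iota.
by move: kn; rewrite mem_iota.
Qed.

Section recursive_closure.
Variable A : nat -> bool.

Lemma mkctx_ext n s t : (forall i, (i < n)%N -> s i = t i) ->
  mkctx n s = mkctx n t.
Proof.
elim: n s t => //= n IH s t st; rewrite st//; congr pair.
by apply: IH => i ni; apply: st.
Qed.

Lemma Rec_comp m n (f : ctx m -> nat) (g : nat -> ctx n -> nat) :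
  Rec A f -> (forall i, (i < m)%N -> Rec A (g i)) ->
  Rec A (fun v => f (mkctx m (fun i => g i v))).
Proof.
move=> hf hg.
apply: (rec_comp hf (g := fun (i : 'I_m) v => g i (mkctx n (nth 0%N v)))) => [i|v].
  exact: hg.
congr f; apply: mkctx_ext => i im.
by rewrite -(tnth_nth 0%N _ (Ordinal im)) tnth_mktuple.
Qed.

Lemma Rec_var0 n : Rec A (fun v : ctx n.+1 => v.1).
Proof.
have := rec_proj A (@ord0 n); rewrite /Rec/=; congr recursive_in.
by apply/funext => v; rewrite (tnth_nth 0%N).
Qed.

Lemma Rec_weak n (f : ctx n -> nat) : Rec A f -> Rec A (fun v : ctx n.+1 => f v.2).
Proof.
move=> hf.
apply: (rec_comp hf
  (g := fun (i : 'I_n) (v : n.+1.-tuple nat) => tnth v (lift ord0 i))).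
  by move=> i; exact: rec_proj.
move=> v; congr f; apply: mkctx_ext => i im.
rewrite -(tnth_nth 0%N _ (Ordinal im)) tnth_mktuple.
by rewrite (tnth_nth 0%N).
Qed.

Lemma Rec_var1 n : Rec A (fun v : ctx n.+2 => v.2.1).
Proof. exact: (Rec_weak (Rec_var0 _)). Qed.
Lemma Rec_var2 n : Rec A (fun v : ctx n.+3 => v.2.2.1).
Proof. exact: (Rec_weak (Rec_var1 _)). Qed.
Lemma Rec_var3 n : Rec A (fun v : ctx n.+4 => v.2.2.2.1).
Proof. exact: (Rec_weak (Rec_var2 _)). Qed.
Lemma Rec_var4 n : Rec A (fun v : ctx n.+4.+1 => v.2.2.2.2.1).
Proof. exact: (Rec_weak (Rec_var3 _)). Qed.
Lemma Rec_var5 n : Rec A (fun v : ctx n.+4.+2 => v.2.2.2.2.2.1).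
Proof. exact: (Rec_weak (Rec_var4 _)). Qed.
Lemma Rec_var6 n : Rec A (fun v : ctx n.+4.+3 => v.2.2.2.2.2.2.1).
Proof. exact: (Rec_weak (Rec_var5 _)). Qed.

Lemma Rec_app1 n (f : nat -> nat) (x : ctx n -> nat) :
  Rec A (fun v : ctx 1 => f v.1) -> Rec A x -> Rec A (fun v => f (x v)).
Proof. by move=> hf hx; apply: (Rec_comp (g := fun _ => x) hf). Qed.

Lemma Rec_app2 n (f : nat -> nat -> nat) (x y : ctx n -> nat) :
  Rec A (fun v : ctx 2 => f v.1 v.2.1) -> Rec A x -> Rec A y ->
  Rec A (fun v => f (x v) (y v)).
Proof.
move=> hf hx hy.
by apply: (Rec_comp (g := nth y [:: x; y]) hf) => -[|[|]].
Qed.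

Lemma Rec_app3 n (f : nat -> nat -> nat -> nat) (x y z : ctx n -> nat) :
  Rec A (fun v : ctx 3 => f v.1 v.2.1 v.2.2.1) ->
  Rec A x -> Rec A y -> Rec A z -> Rec A (fun v => f (x v) (y v) (z v)).
Proof.
move=> hf hx hy hz.
by apply: (Rec_comp (g := nth y [:: x; y; z]) hf) => -[|[|[|]]].
Qed.

Lemma Rec_app4 n (f : nat -> nat -> nat -> nat -> nat) (x y z t : ctx n -> nat) :
  Rec A (fun v : ctx 4 => f v.1 v.2.1 v.2.2.1 v.2.2.2.1) ->
  Rec A x -> Rec A y -> Rec A z -> Rec A t ->
  Rec A (fun v => f (x v) (y v) (z v) (t v)).
Proof.
move=> hf hx hy hz ht.
by apply: (Rec_comp (g := nth y [:: x; y; z; t]) hf) => -[|[|[|[|]]]].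
Qed.

Lemma Rec_prim n (f : ctx n -> nat) (g : ctx n.+2 -> nat) (h : ctx n.+1 -> nat) :
  Rec A f -> Rec A g -> (forall v, h (0%N, v) = f v) ->
  (forall k v, h (k.+1, v) = g (k, (h (k, v), v))) -> Rec A h.
Proof. by move=> hf hg h0 hS; apply: (rec_prim hf hg) => [v|k v] /=. Qed.

Fixpoint seq_of_ctx n : ctx n -> seq nat :=
  match n return ctx n -> seq nat with
  | 0 => fun _ => [::]
  | n'.+1 => fun v => v.1 :: seq_of_ctx v.2
  end.

Lemma seq_of_ctxK n (v : ctx n) : mkctx n (nth 0%N (seq_of_ctx v)) = v.
Proof. by elim: n v => [[]|n IH [k v]] //=; rewrite IH. Qed.

Lemma Rec_nth n i : (i < n)%N -> Rec A (fun v : ctx n => nth 0%N (seq_of_ctx v) i).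
Proof.
elim: n i => // n IH [|i] ni; first exact: Rec_var0.
exact: (Rec_weak (IH i ni)).
Qed.

Lemma Rec_subst n (f : ctx n.+1 -> nat) (b : ctx n -> nat) :
  Rec A f -> Rec A b -> Rec A (fun v => f (b v, v)).
Proof.
move=> hf hb.
pose g i (v : ctx n) := if i is i'.+1 then nth 0%N (seq_of_ctx v) i' else b v.
have -> : (fun v => f (b v, v)) = fun v => f (mkctx n.+1 (g ^~ v)).
  by apply/funext => v /=; rewrite seq_of_ctxK.
by apply: Rec_comp hf _ => -[_|i ni] //; exact: (@Rec_nth n i ni).
Qed.

(** The body of a bounded quantifier sees the index and the context, a step of primitive recursion
    also the previous value; this inserts the extra argument. *)
Lemma Rec_skip n (f : ctx n.+1 -> nat) :
  Rec A f -> Rec A (fun w : ctx n.+2 => f (w.1, w.2.2)).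
Proof.
move=> hf.
pose g i (w : ctx n.+2) := if i is i'.+1 then nth 0%N (seq_of_ctx w.2.2) i' else w.1.
have -> : (fun w : ctx n.+2 => f (w.1, w.2.2)) = fun v => f (mkctx n.+1 (g ^~ v)).
  by apply/funext => v /=; rewrite seq_of_ctxK.
apply: Rec_comp hf _ => -[_|i ni] /=; first exact: Rec_var0.
exact: (Rec_weak (Rec_weak (@Rec_nth n i ni))).
Qed.

Lemma Rec_prec n (b x : ctx n -> nat) (g : ctx n -> nat -> nat -> nat) :
  Rec A b -> Rec A x -> Rec A (fun w : ctx n.+2 => g w.2.2 w.1 w.2.1) ->
  Rec A (fun v => prec (x v) (g v) (b v)).
Proof.
move=> hb hx hg.
apply: (Rec_subst (f := fun w => prec (x w.2) (g w.2) w.1)) hb.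
by apply: (Rec_prim hx hg).
Qed.

Lemma Rec_const n c : Rec A (fun _ : ctx n => c).
Proof.
elim: c => [|c IH]; first exact: rec_zero.
apply: (Rec_app1 (f := S)) IH.
have := rec_succ A; rewrite /Rec/=; congr recursive_in.
by apply/funext => v; rewrite /thead (tnth_nth 0%N).
Qed.

Lemma Rec_S n (x : ctx n -> nat) : Rec A x -> Rec A (fun v => (x v).+1).
Proof.
apply: (Rec_app1 (f := S)).
have := rec_succ A; rewrite /Rec/=; congr recursive_in.
by apply/funext => v; rewrite /thead (tnth_nth 0%N).
Qed.

Lemma Rec_pred n (x : ctx n -> nat) : Rec A x -> Rec A (fun v => (x v).-1).
Proof.
apply: (Rec_app1 (f := predn)).
apply: (@Rec_prim 0 (fun _ => 0%N) (fun v => v.1)) => //; first exact: Rec_const.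
exact: Rec_var0.
Qed.

Lemma Rec_add n (x y : ctx n -> nat) :
  Rec A x -> Rec A y -> Rec A (fun v => x v + y v)%N.
Proof.
move=> hx hy.
have -> : (fun v => x v + y v)%N = fun v => prec (y v) (fun _ r => r.+1) (x v).
  by apply/funext => v; elim: (x v) => //= k <-.
by apply: (Rec_prec (g := fun v _ r => r.+1)) => //; apply: Rec_S; exact: Rec_var1.
Qed.

Lemma Rec_sub n (x y : ctx n -> nat) :
  Rec A x -> Rec A y -> Rec A (fun v => x v - y v)%N.
Proof.
move=> hx hy.
have -> : (fun v => x v - y v)%N = fun v => prec (x v) (fun _ r => r.-1) (y v).
  by apply/funext => v; elim: (y v) => [|k /= <-]; rewrite ?subn0 ?subnS.
by apply: (Rec_prec (g := fun v _ r => r.-1)) => //; apply: Rec_pred; exact: Rec_var1.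
Qed.

Lemma Rec_mul n (x y : ctx n -> nat) :
  Rec A x -> Rec A y -> Rec A (fun v => x v * y v)%N.
Proof.
move=> hx hy.
have -> : (fun v => x v * y v)%N = fun v => prec 0%N (fun _ r => y v + r)%N (x v).
  by apply/funext => v; elim: (x v) => //= k <-.
apply: (Rec_prec (g := fun v _ r => y v + r)%N) => //; first exact: Rec_const.
by apply: Rec_add; [exact: (Rec_weak (Rec_weak hy)) | exact: Rec_var1].
Qed.

Lemma Rec_exp n (x y : ctx n -> nat) :
  Rec A x -> Rec A y -> Rec A (fun v => x v ^ y v)%N.
Proof.
move=> hx hy.
have -> : (fun v => x v ^ y v)%N = fun v => prec 1%N (fun _ r => x v * r)%N (y v).
  by apply/funext => v; elim: (y v) => //= k <-; rewrite expnS.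
apply: (Rec_prec (g := fun v _ r => x v * r)%N) => //; first exact: Rec_const.
by apply: Rec_mul; [exact: (Rec_weak (Rec_weak hx)) | exact: Rec_var1].
Qed.

Lemma Rec_negb n (P : ctx n -> bool) : Rec A (fun v => nat_of_bool (P v)) ->
  Rec A (fun v => nat_of_bool (~~ P v)).
Proof.
move=> hP; have -> : (fun v => nat_of_bool (~~ P v)) = fun v => (1 - P v)%N.
  by apply/funext => v; case: (P v).
by apply: Rec_sub => //; exact: Rec_const.
Qed.

Lemma Rec_leq n (x y : ctx n -> nat) :
  Rec A x -> Rec A y -> Rec A (fun v => nat_of_bool (x v <= y v)%N).
Proof.
move=> hx hy.
have -> : (fun v => nat_of_bool (x v <= y v)%N) = fun v => (1 - (x v - y v))%N.
  by apply/funext => v; rewrite -subn_eq0; case: subn.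
by apply: Rec_sub; [exact: Rec_const | exact: Rec_sub].
Qed.

Lemma Rec_andb n (P Q : ctx n -> bool) : Rec A (fun v => nat_of_bool (P v)) ->
  Rec A (fun v => nat_of_bool (Q v)) -> Rec A (fun v => nat_of_bool (P v && Q v)).
Proof.
move=> hP hQ.
have -> : (fun v => nat_of_bool (P v && Q v)) = fun v => (P v * Q v)%N.
  by apply/funext => v; rewrite mulnb.
exact: Rec_mul.
Qed.

Lemma Rec_orb n (P Q : ctx n -> bool) : Rec A (fun v => nat_of_bool (P v)) ->
  Rec A (fun v => nat_of_bool (Q v)) -> Rec A (fun v => nat_of_bool (P v || Q v)).
Proof.
move=> hP hQ.
have -> : (fun v => nat_of_bool (P v || Q v)) =
    fun v => nat_of_bool (~~ (~~ P v && ~~ Q v)).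
  by apply/funext => v; rewrite -negb_or negbK.
by apply/Rec_negb/Rec_andb; exact: Rec_negb.
Qed.

Lemma Rec_implyb n (P Q : ctx n -> bool) : Rec A (fun v => nat_of_bool (P v)) ->
  Rec A (fun v => nat_of_bool (Q v)) -> Rec A (fun v => nat_of_bool (P v ==> Q v)).
Proof.
move=> hP hQ.
have -> : (fun v => nat_of_bool (P v ==> Q v)) = fun v => nat_of_bool (~~ P v || Q v).
  by apply/funext => v; rewrite implybE.
by apply: Rec_orb => //; exact: Rec_negb.
Qed.

Lemma Rec_eq n (x y : ctx n -> nat) :
  Rec A x -> Rec A y -> Rec A (fun v => nat_of_bool (x v == y v)).
Proof.
move=> hx hy.
have -> : (fun v => nat_of_bool (x v == y v)) =
    fun v => nat_of_bool ((x v <= y v) && (y v <= x v))%N.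
  by apply/funext => v; rewrite eqn_leq.
by apply: Rec_andb; exact: Rec_leq.
Qed.

Lemma Rec_eqb n (P Q : ctx n -> bool) : Rec A (fun v => nat_of_bool (P v)) ->
  Rec A (fun v => nat_of_bool (Q v)) -> Rec A (fun v => nat_of_bool (P v == Q v)).
Proof.
move=> hP hQ.
have -> : (fun v => nat_of_bool (P v == Q v)) =
    fun v => nat_of_bool (nat_of_bool (P v) == nat_of_bool (Q v)).
  by apply/funext => v; case: (P v); case: (Q v).
exact: Rec_eq.
Qed.

Lemma Rec_if n (P : ctx n -> bool) (x y : ctx n -> nat) :
  Rec A (fun v => nat_of_bool (P v)) -> Rec A x -> Rec A y ->
  Rec A (fun v => if P v then x v else y v).
Proof.
move=> hP hx hy.
have -> : (fun v => if P v then x v else y v) =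
    fun v => (P v * x v + (~~ P v) * y v)%N.
  by apply/funext => v; case: (P v); rewrite ?mul1n ?mul0n ?addn0.
by apply: Rec_add; apply: Rec_mul => //; exact: Rec_negb.
Qed.

Lemma Rec_ifb n (P Q Q' : ctx n -> bool) :
  Rec A (fun v => nat_of_bool (P v)) -> Rec A (fun v => nat_of_bool (Q v)) ->
  Rec A (fun v => nat_of_bool (Q' v)) ->
  Rec A (fun v => nat_of_bool (if P v then Q v else Q' v)).
Proof.
move=> hP hx hy; have := Rec_if hP hx hy; congr Rec.
by apply/funext => v; case: (P v).
Qed.

Lemma Rec_ballb n (b : ctx n -> nat) (P : ctx n -> nat -> bool) :
  Rec A b -> Rec A (fun w : ctx n.+1 => nat_of_bool (P w.2 w.1)) ->
  Rec A (fun v => nat_of_bool (ballb (b v) (P v))).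
Proof.
move=> hb hP.
have -> : (fun v => nat_of_bool (ballb (b v) (P v))) =
    fun v => prec 1%N (fun k r => r * P v k)%N (b v).
  apply/funext => v; elim: (b v) => //= k <-.
  by rewrite /ballb -addn1 iotaD all_cat /= add0n andbT mulnb.
apply: (Rec_prec (g := fun v k r => (r * P v k)%N)) => //; first exact: Rec_const.
by apply: Rec_mul; [exact: Rec_var1 | exact: (Rec_skip hP)].
Qed.

Lemma Rec_bexb n (b : ctx n -> nat) (P : ctx n -> nat -> bool) :
  Rec A b -> Rec A (fun w : ctx n.+1 => nat_of_bool (P w.2 w.1)) ->
  Rec A (fun v => nat_of_bool (bexb (b v) (P v))).
Proof.
move=> hb hP.
have -> : (fun v => nat_of_bool (bexb (b v) (P v))) =
    fun v => nat_of_bool (~~ ballb (b v) (fun k => ~~ P v k)).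
  by apply/funext => v; rewrite /ballb all_predC negbK.
apply/Rec_negb/Rec_ballb => //; exact: (Rec_negb hP).
Qed.

Lemma Rec_mu n (P : ctx n -> nat -> bool) :
  (forall v, exists k, P v k) -> Rec A (fun w : ctx n.+1 => nat_of_bool (P w.2 w.1)) ->
  Rec A (fun v => mu (P v)).
Proof.
move=> ex /Rec_negb hN; apply: (rec_min hN) => v /=; set w := mkctx _ _.
have [h1 h2] := muP (ex w); split; first by rewrite h1.
by move=> k kh; have := contra (h2 k); rewrite -ltnNge => /(_ kh) ->.
Qed.

Lemma Rec_odd n (x : ctx n -> nat) :
  Rec A x -> Rec A (fun v => nat_of_bool (odd (x v))).
Proof.
move=> hx.
have -> : (fun v => nat_of_bool (odd (x v))) =
    fun v => prec 0%N (fun _ r => 1 - r)%N (x v).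
  by apply/funext => v; elim: (x v) => //= k <-; case: odd.
apply: (Rec_prec (g := fun v _ r => 1 - r)%N) => //; first exact: Rec_const.
by apply: Rec_sub; [exact: Rec_const | exact: Rec_var1].
Qed.

Lemma Rec_half n (x : ctx n -> nat) : Rec A x -> Rec A (fun v => (x v)./2).
Proof.
move=> hx.
have -> : (fun v => (x v)./2) = fun v => prec 0%N (fun k r => odd k + r)%N (x v).
  by apply/funext => v; elim: (x v) => //= k <-; rewrite uphalf_half.
apply: (Rec_prec (g := fun v k r => odd k + r)%N) => //; first exact: Rec_const.
by apply: Rec_add; [apply: Rec_odd; exact: Rec_var0 | exact: Rec_var1].
Qed.

Lemma Rec_iter n (f : ctx n -> nat -> nat) (x y : ctx n -> nat) :
  Rec A x -> Rec A y -> Rec A (fun w : ctx n.+1 => f w.2 w.1) ->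
  Rec A (fun v => iter (x v) (f v) (y v)).
Proof.
move=> hx hy hf.
have -> : (fun v => iter (x v) (f v) (y v)) =
    fun v => prec (y v) (fun _ r => f v r) (x v).
  by apply/funext => v; elim: (x v) => //= k <-.
by apply: (Rec_prec (g := fun v _ r => f v r)) => //; exact: (Rec_weak hf).
Qed.

End recursive_closure.

(* Automation for proofs of recursiveness *)
Create HintDb rec.

Ltac rec_solved := cbv beta; solve [assumption | eauto 2 with rec nocore].

Ltac rec_is_if f := lazymatch type of f with ?T -> _ =>
  let _ := constr:(fun v : T => ltac:(
    let e := eval cbv beta in (f v) in
    lazymatch e with
    | (if _ then _ else _) => exact tt
    | nat_of_bool (if _ then _ else _) => exact tt
    end)) in idtac
end.

(** Descends through the term. A function other than the listed operations has to be recursive by a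
    hypothesis or by a hint in [rec]; the existence of a witness for each [mu] is left as a goal. *)
Ltac rec_tac := cbv beta; lazymatch goal with
| |- Rec _ (fun _ => ?c) => exact: Rec_const
| |- Rec _ (fun v => (@?x v).+1) => apply: Rec_S; rec_tac
| |- Rec _ (fun v => (@?x v).-1) => apply: Rec_pred; rec_tac
| |- Rec _ (fun v => (@?x v)./2) => apply: Rec_half; rec_tac
| |- Rec _ (fun v => addn (@?x v) (@?y v)) => apply: Rec_add; rec_tac
| |- Rec _ (fun v => subn (@?x v) (@?y v)) => apply: Rec_sub; rec_tac
| |- Rec _ (fun v => muln (@?x v) (@?y v)) => apply: Rec_mul; rec_tac
| |- Rec _ (fun v => expn (@?x v) (@?y v)) => apply: Rec_exp; rec_tac
| |- Rec _ (fun v => mu (@?P v)) => apply: (@Rec_mu _ _ P); [ | rec_tac]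
| |- Rec _ (fun v => iter (@?x v) (@?f v) (@?y v)) =>
    apply: (@Rec_iter _ _ f x y); rec_tac
| |- Rec _ (fun v => prec (@?x v) (@?g v) (@?b v)) =>
    apply: (@Rec_prec _ _ b x g); rec_tac
| |- Rec _ (fun v => nat_of_bool (~~ @?P v)) => apply: (@Rec_negb _ _ P); rec_tac
| |- Rec _ (fun v => nat_of_bool (odd (@?x v))) => apply: (@Rec_odd _ _ x); rec_tac
| |- Rec _ (fun v => nat_of_bool (andb (@?P v) (@?Q v))) =>
    apply: (@Rec_andb _ _ P Q); rec_tac
| |- Rec _ (fun v => nat_of_bool (orb (@?P v) (@?Q v))) =>
    apply: (@Rec_orb _ _ P Q); rec_tac
| |- Rec _ (fun v => nat_of_bool (implb (@?P v) (@?Q v))) =>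
    apply: (@Rec_implyb _ _ P Q); rec_tac
| |- Rec _ (fun v => nat_of_bool (leq (@?x v) (@?y v))) =>
    apply: (@Rec_leq _ _ x y); rec_tac
| |- Rec _ (fun v => nat_of_bool (@eq_op _ (@?x v) (@?y v))) =>
    first [apply: (@Rec_eq _ _ x y) | apply: (@Rec_eqb _ _ x y)]; rec_tac
| |- Rec _ (fun v => nat_of_bool (ballb (@?x v) (@?P v))) =>
    apply: (@Rec_ballb _ _ x P); rec_tac
| |- Rec _ (fun v => nat_of_bool (bexb (@?x v) (@?P v))) =>
    apply: (@Rec_bexb _ _ x P); rec_tac
| |- Rec _ _ => first
  [ exact: Rec_var0 | exact: Rec_var1 | exact: Rec_var2 | exact: Rec_var3
  | exact: Rec_var4 | exact: Rec_var5 | exact: Rec_var6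
  | lazymatch goal with
    | |- Rec _ (fun v => nat_of_bool (?f (@?x v) (@?y v) (@?z v) (@?t v))) =>
       apply: (@Rec_app4 _ _ (fun a b c d => nat_of_bool (f a b c d)) x y z t);
         [rec_solved | rec_tac ..]
    end
  | lazymatch goal with
    | |- Rec _ (fun v => nat_of_bool (?f (@?x v) (@?y v) (@?z v))) =>
       apply: (@Rec_app3 _ _ (fun a b c => nat_of_bool (f a b c)) x y z);
         [rec_solved | rec_tac ..]
    end
  | lazymatch goal with
    | |- Rec _ (fun v => nat_of_bool (?f (@?x v) (@?y v))) =>
       apply: (@Rec_app2 _ _ (fun a b => nat_of_bool (f a b)) x y);
         [rec_solved | rec_tac ..]
    end
  | lazymatch goal with
    | |- Rec _ (fun v => nat_of_bool (?f (@?x v))) =>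
       apply: (@Rec_app1 _ _ (fun a => nat_of_bool (f a)) x);
         [rec_solved | rec_tac ..]
    end
  | lazymatch goal with
    | |- Rec _ (fun v => ?f (@?x v) (@?y v) (@?z v) (@?t v)) =>
       apply: (@Rec_app4 _ _ f x y z t); [rec_solved | rec_tac ..]
    end
  | lazymatch goal with
    | |- Rec _ (fun v => ?f (@?x v) (@?y v) (@?z v)) =>
       apply: (@Rec_app3 _ _ f x y z); [rec_solved | rec_tac ..]
    end
  | lazymatch goal with
    | |- Rec _ (fun v => ?f (@?x v) (@?y v)) =>
       apply: (@Rec_app2 _ _ f x y); [rec_solved | rec_tac ..]
    end
  | lazymatch goal with
    | |- Rec _ (fun v => ?f (@?x v)) =>
       apply: (@Rec_app1 _ _ f x); [rec_solved | rec_tac ..]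
    end
  | lazymatch goal with |- Rec _ ?f => rec_is_if f end;
    first [apply: Rec_ifb | apply: Rec_if]; rec_tac
  | idtac ]
| |- _ => idtac
end.

(** * Sequences coded by [CodeSeq] *)

(** The code of [n :: s] is 2^n (2 m + 1) with m the code of [s], so the head is the exponent of 2.
    The disjunct for 0 stops the search on the empty list with the value 0, the default of [nth]
    used in the definitions. *)
Definition hdc (c : nat) : nat := mu (fun k => (c == 0%N) || odd (iter k half c)).
Definition tlc (c : nat) : nat := (iter (hdc c) half c)./2.
Definition nthc (c i : nat) : nat := hdc (iter i tlc c).
Definition sizec (c : nat) : nat := mu (fun k => iter k tlc c == 0%N).

Lemma hdc0 : hdc 0 = 0%N.
Proof.
have [] := @muP (fun k => (0 == 0 :> nat) || odd (iter k half 0)).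
  by exists 0%N.
by rewrite -/(hdc 0) => _ /(_ 0%N isT); case: (hdc 0).
Qed.

Lemma iter_half_code n m : iter n half (2 ^ n * m) = m.
Proof.
elim: n m => [|n IH] m; first by rewrite mul1n.
by rewrite iterSr expnS -mulnA mul2n doubleK.
Qed.

Lemma hdc_ex c : exists k, (c == 0%N) || odd (iter k half c).
Proof.
rewrite -[c]CodeSeq.decodeK; case: (CodeSeq.decode c) => [|n s]; first by exists 0%N.
by exists n; rewrite /= iter_half_code /= odd_double orbT.
Qed.

Lemma hdc_cons n s : hdc (CodeSeq.code (n :: s)) = n.
Proof.
have [] := muP (hdc_ex (CodeSeq.code (n :: s))).
rewrite -/(hdc _); set h := hdc _; rewrite [_ == 0%N]gtn_eqF ?muln_gt0 ?expn_gt0 //=.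
move=> + /(_ n); rewrite iter_half_code /= odd_double /= => + /(_ isT) hn.
move: hn; rewrite leq_eqVlt => /predU1P[->//|hn].
rewrite -(subnKC (ltnW hn)) expnD -mulnA iter_half_code.
by rewrite oddM oddX subn_eq0 leqNgt hn.
Qed.

Lemma tlc_cons n s : tlc (CodeSeq.code (n :: s)) = CodeSeq.code s.
Proof. by rewrite /tlc hdc_cons /= iter_half_code /= uphalf_double. Qed.

Lemma tlc0 : tlc 0 = 0%N.
Proof. by rewrite /tlc hdc0. Qed.

Lemma iter_tlc i s : iter i tlc (CodeSeq.code s) = CodeSeq.code (drop i s).
Proof.
elim: i s => [|i IH] s; first by rewrite drop0.
case: s => [|n s]; rewrite iterSr; last by rewrite tlc_cons IH.
by rewrite [tlc _]tlc0 -[0%N]/(CodeSeq.code [::]) IH.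
Qed.

Lemma nthcE c i : nthc c i = nth 0%N (CodeSeq.decode c) i.
Proof.
rewrite -{1}[c]CodeSeq.decodeK /nthc iter_tlc -[i in RHS]addn0 -nth_drop.
by case: drop => [|n s]; rewrite ?hdc0 ?hdc_cons.
Qed.

Lemma code_eq0 s : (CodeSeq.code s == 0%N) = (s == [::]).
Proof. by case: s => //= n s; rewrite muln_eq0 expn_eq0. Qed.

Lemma iter_tlc_eq0 c k : (iter k tlc c == 0%N) = (size (CodeSeq.decode c) <= k)%N.
Proof.
by rewrite -{1}[c]CodeSeq.decodeK iter_tlc code_eq0 -size_eq0 size_drop subn_eq0.
Qed.

Lemma sizec_ex c : exists k, iter k tlc c == 0%N.
Proof. by exists (size (CodeSeq.decode c)); rewrite iter_tlc_eq0. Qed.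

Lemma sizecE c : sizec c = size (CodeSeq.decode c).
Proof.
have [] := muP (sizec_ex c); rewrite -/(sizec c) iter_tlc_eq0 => ks.
move=> /(_ (size (CodeSeq.decode c))); rewrite iter_tlc_eq0 leqnn => /(_ isT) sk.
by apply/eqP; rewrite eqn_leq ks sk.
Qed.

Lemma decode_onto s : exists c, CodeSeq.decode c = s.
Proof. by exists (CodeSeq.code s); exact: CodeSeq.codeK. Qed.

Section code_recursive.
Variable A : nat -> bool.

Lemma Rec_hdc : Rec A (fun v : ctx 1 => hdc v.1).
Proof. by rewrite /hdc; rec_tac => v; exact: hdc_ex. Qed.
Hint Resolve Rec_hdc : rec.

Lemma Rec_tlc : Rec A (fun v : ctx 1 => tlc v.1).
Proof. by rewrite /tlc; rec_tac. Qed.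
Hint Resolve Rec_tlc : rec.

Lemma Rec_nthc : Rec A (fun v : ctx 2 => nthc v.1 v.2.1).
Proof. by rewrite /nthc; rec_tac. Qed.

Lemma Rec_sizec : Rec A (fun v : ctx 1 => sizec v.1).
Proof. by rewrite /sizec; rec_tac => v; exact: sizec_ex. Qed.

End code_recursive.

#[export] Hint Resolve Rec_nthc Rec_sizec : rec.

Local Open Scope ring_scope.

(** * Branches of the tree of finite meets *)

Definition agree (x y : nat -> bool) (n : nat) : Prop :=
  forall i, (i < n)%N -> x i = y i.

Section branches.
Context {disp : Order.disp_t} {B : ctbDistrLatticeType disp}.
Variable b : nat -> B.

Definition lit (i : nat) (c : bool) : B := if c then b i else (~` b i)%O.

Fixpoint bmeets (x : nat -> bool) (n : nat) : B :=
  if n is n'.+1 then (bmeets x n' `&` lit n' (x n'))%O else \top%O.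

Definition branch (x : nat -> bool) : Prop := forall n, bmeets x n != \bot%O.

Lemma bmeets_agree x y n : agree x y n -> bmeets x n = bmeets y n.
Proof.
elim: n => //= n IH xy; rewrite (xy n)// IH// => i ni.
by apply: xy; exact: ltnW.
Qed.

Lemma bmeets_le x m n : (m <= n)%N -> (bmeets x n <= bmeets x m)%O.
Proof.
elim: n => [|n IH]; first by rewrite leqn0 => /eqP ->.
rewrite leq_eqVlt => /predU1P[->//|mn].
by apply: le_trans (IH mn); exact: leIl.
Qed.

Lemma bmeets_lit x i n : (i < n)%N -> (bmeets x n <= lit i (x i))%O.
Proof. by move=> /(bmeets_le x) /le_trans; apply; exact: leIr. Qed.

Lemma litN i c : lit i (~~ c) = (~` lit i c)%O.
Proof. by case: c => //=; rewrite complK. Qed.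

(** The meet reached from [c] when a digit of [p] is followed unless it would give zero. Starting at
    the top yields the dense sequence; starting at another nonzero element yields a branch through
    that element. *)
Fixpoint gst (c : B) (p : nat -> bool) (n : nat) : B :=
  if n is n'.+1 then
    let y := (gst c p n' `&` lit n' (p n'))%O in
    if y != \bot%O then y else (gst c p n' `&` lit n' (~~ p n'))%O
  else c.

Definition greedy (c : B) (p : nat -> bool) (n : nat) : bool :=
  if (gst c p n `&` lit n (p n))%O != \bot%O then p n else ~~ p n.

(** A nonzero element cannot have zero meet with both a literal and its complement. *)
Lemma gst_neq0 c p n : c != \bot%O -> gst c p n != \bot%O.
Proof.
move=> c0; elim: n => //= n IH; case: ifP => // /negbFE/eqP h.
apply: contra_neq IH => h'.
rewrite -[gst c p n]meetx1 -(joinxC (lit n (p n))) meetUr h -litN h' joinxx//.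
Qed.

Lemma gstE c p n : gst c p n = (c `&` bmeets (greedy c p) n)%O.
Proof.
elim: n => [|n IH] /=; first by rewrite meetx1.
by rewrite meetA -IH /greedy; case: ifP.
Qed.

Lemma greedy_branch c p : c != \bot%O -> branch (greedy c p).
Proof.
move=> c0 n; apply: contra_neq (gst_neq0 p n c0) => h.
by rewrite gstE h meetx0.
Qed.

Lemma gst_top p n : gst \top%O p n = bmeets (greedy \top%O p) n.
Proof. by rewrite gstE meet1x. Qed.

(** The digits of a branch never need a correction, because all its finite meets are nonzero. *)
Lemma greedy_agree x p n : branch x -> agree x p n -> agree x (greedy \top%O p) n.
Proof.
move=> bx xp i; elim: i {-2}i (leqnn i) => [|k IH] i ik ni.
  move: ik; rewrite leqn0 => /eqP ->.
  by rewrite /greedy /= -(xp 0%N) ?(leq_ltn_trans _ ni)// (bx 1%N).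
have xg : agree x (greedy \top%O p) i.
  by move=> j ji; apply: IH; [rewrite -ltnS (leq_trans ji)|exact: ltn_trans ni].
rewrite /greedy gst_top -(bmeets_agree xg) -(xp i ni).
by have := bx i.+1; rewrite /= => ->.
Qed.

(** The meet reached depends only on the values chosen so far, so equal choices below [n] and equal
    digits from [n] on give equal choices forever. This reduces equality of two points to a finite
    check. *)
Lemma greedy_eq p q n : (forall k, (n <= k)%N -> p k = q k) ->
  agree (greedy \top%O p) (greedy \top%O q) n -> greedy \top%O p =1 greedy \top%O q.
Proof.
move=> pq; suff h m : agree (greedy \top%O p) (greedy \top%O q) n ->
    agree (greedy \top%O p) (greedy \top%O q) (n + m)%N.
  by move=> /h{}h k; apply: (h k.+1); rewrite addnS ltnS leq_addl.
elim: m => [|m IH]; first by rewrite addn0.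
move=> /IH{IH} ag i; rewrite addnS ltnS leq_eqVlt => /predU1P[->|]; last exact: ag.
by rewrite /greedy !gst_top (bmeets_agree ag) pq// leq_addr.
Qed.

End branches.

(** * The metric of the first difference *)

Section branch_metric.
Variable R : realType.
Implicit Types x y z : nat -> bool.

Definition bdist x y : R :=
  if pselect (x = y) then 0 else 2^-1 ^+ mu (fun k => x k != y k).

Lemma half_gt0 : 0 < 2^-1 :> R. Proof. by rewrite invr_gt0. Qed.

Lemma half_exp_gt0 n : 0 < 2^-1 ^+ n :> R.
Proof. by rewrite exprn_gt0// half_gt0. Qed.

Lemma half_exp_le m n : (2^-1 ^+ m <= 2^-1 ^+ n :> R) = (n <= m)%N.
Proof. by rewrite ler_iXn2l ?half_gt0// invf_lt1// ltr1n. Qed.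

Lemma half_exp_lt (e : R) : 0 < e -> exists n, 2^-1 ^+ n < e.
Proof.
move=> e0; exists (Num.truncn e^-1).+1.
rewrite exprVn -[ltRHS]invrK ltf_pV2 ?posrE ?invr_gt0 ?exprn_gt0//.
apply: (lt_trans (truncnS_gt _)).
by rewrite -natrX ltr_nat ltn_expl.
Qed.

Lemma bdistxx x : bdist x x = 0.
Proof. by rewrite /bdist; case: pselect. Qed.

Lemma bdist_ge0 x y : 0 <= bdist x y.
Proof. by rewrite /bdist; case: pselect => // _; exact/ltW/half_exp_gt0. Qed.

Lemma bdist_sym x y : bdist x y = bdist y x.
Proof.
rewrite /bdist; case: pselect => xy; case: pselect => yx //=.
- by case: yx; rewrite xy.
- by case: xy; rewrite yx.
by congr (_ ^+ mu _); apply/funext => k; rewrite eq_sym.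
Qed.

Lemma fdiff_ex x y : x <> y -> exists k, x k != y k.
Proof.
move=> xy; apply: contrapT => h; apply: xy; apply/funext => k.
by apply/eqP/negPn/negP => xyk; apply: h; exists k.
Qed.

Lemma bdist_eq0 x y : bdist x y = 0 -> x = y.
Proof.
by rewrite /bdist; case: pselect => // _ /eqP; rewrite gt_eqF// half_exp_gt0.
Qed.

Lemma bdist_neq x y : x <> y ->
  exists k, [/\ bdist x y = 2^-1 ^+ k, x k != y k & agree x y k].
Proof.
move=> xy; rewrite /bdist; case: pselect => //= _.
have [h1 h2] := muP (fdiff_ex xy); exists (mu (fun k => x k != y k)).
split=> // i ik; apply/eqP/negPn/negP => /h2.
by rewrite leqNgt ik.
Qed.

Lemma bdist_le x y n : bdist x y <= 2^-1 ^+ n <-> agree x y n.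
Proof.
have [->|xy] := pselect (x = y).
  by rewrite bdistxx; split => // _; exact/ltW/half_exp_gt0.
have [k [-> xyk ag]] := bdist_neq xy; rewrite half_exp_le; split => [nk i ni|ag'].
  by apply: ag; exact: leq_trans nk.
by rewrite leqNgt; apply/negP => /ag' /eqP; rewrite (negbTE xyk).
Qed.

Lemma bdist_ge x y k : x k != y k -> 2^-1 ^+ k <= bdist x y.
Proof.
move=> xyk; rewrite leNgt; apply/negP => h.
have xy : x <> y by move=> e; rewrite e eqxx in xyk.
have [j [hj xyj ag]] := bdist_neq xy.
move: h; rewrite hj ltNge half_exp_le => /negP; apply.
by rewrite leqNgt; apply/negP => /ag/eqP; rewrite (negbTE xyk).
Qed.

(** At the first place where [x] and [z] differ, [y] differs from one of them. *)
Lemma bdist_triangle y x z : bdist x z <= bdist x y + bdist y z.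
Proof.
have [->|xz] := pselect (x = z); first by rewrite bdistxx addr_ge0// bdist_ge0.
have [k [-> xzk _]] := bdist_neq xz.
have [xyk|xyk] := eqVneq (x k) (y k).
  by rewrite -[leLHS]add0r lerD ?bdist_ge0// bdist_ge// -xyk.
by rewrite -[leLHS]addr0 lerD ?bdist_ge0// bdist_ge.
Qed.

End branch_metric.

(** * Topology of the space of branches *)

Definition branch_space (R : realType) disp (B : ctbDistrLatticeType disp)
  (b : nat -> B) : Type := {x : nat -> bool | branch b x}.

HB.instance Definition _ R disp B b := gen_eqMixin (@branch_space R disp B b).
HB.instance Definition _ R disp B b := gen_choiceMixin (@branch_space R disp B b).

Section branch_space.
Variable R : realType.
Context {disp : Order.disp_t} {B : ctbDistrLatticeType disp}.
Variable b : nat -> B.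
Local Notation X := (branch_space R b).

Lemma branch_space_eq (x y : X) : sval x = sval y -> x = y.
Proof. by move: x y => [x px] [y py] /= e; exact: eq_exist. Qed.

HB.instance Definition _ := @isMetric.Build R X
  (fun x y => bdist R (sval x) (sval y)) (fun x => bdistxx R _)
  (fun x y h => branch_space_eq (bdist_eq0 h)) (fun x y => bdist_sym R _ _)
  (fun y x z => bdist_triangle R (sval y) (sval x) (sval z)).

End branch_space.

Section branch_topology.
Variable R : realType.
Context {disp : Order.disp_t} {B : ctbDistrLatticeType disp}.
Variable b : nat -> B.
Local Notation X := (branch_space R b).

Lemma mdist_branchE (x y : X) : mdist x y = bdist R (sval x) (sval y).
Proof. by []. Qed.

Lemma nbhs_branchP (x : X) (P : set X) :
  nbhs x P <-> exists n, forall y : X, agree (sval x) (sval y) n -> P y.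
Proof.
rewrite -nbhs_ballE; split => [[e e0 eP]|[n nP]].
  have [n ne] := half_exp_lt e0; exists n => y /(bdist_le R) xy.
  by apply: eP; rewrite ballEmdist /= mdist_branchE (le_lt_trans xy).
exists (2^-1 ^+ n); first exact: half_exp_gt0.
move=> y; rewrite ballEmdist /= mdist_branchE => /ltW/bdist_le; exact: nP.
Qed.

Lemma open_coord (n : nat) (c : bool) : open [set x : X | sval x n = c].
Proof.
rewrite openE => x /= xn; apply/nbhs_branchP; exists n.+1 => y /= xy.
by rewrite -(xy n).
Qed.

Lemma clopen_coord (n : nat) : clopen [set x : X | sval x n].
Proof.
split; first exact: (@open_coord n true).
have -> : [set x : X | sval x n] = ~` [set x : X | sval x n = false].
  by apply/seteqP; split => x /=; case: (sval x n).
exact/open_closedC/open_coord.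
Qed.

(** The limit of an ultrafilter is read off coordinate by coordinate. All cylinders around it belong
    to the ultrafilter, hence contain branches, so the limit is itself a branch. *)
Lemma branch_compact : compact [set: X].
Proof.
rewrite compact_ultra => F FU _ /=.
pose x n := `[< F [set y : X | sval y n] >].
have Fx n : F [set y : X | sval y n = x n].
  rewrite /x; case: asboolP => // h.
  have [//|h'] := in_ultra_setVsetC [set y : X | sval y n] FU.
  by apply: filterS h' => y /= /negP/negbTE.
have Fag n : F [set y : X | agree x (sval y) n].
  elim: n => [|n IH]; first by apply: filterE.
  apply: filterS (filterI IH (Fx n)) => y [/= ag yn] i.
  by rewrite ltnS leq_eqVlt => /predU1P[->|/ag].
have bx : branch b x.
  by move=> n; have [y yn] := filter_ex (Fag n); rewrite (bmeets_agree b yn) (svalP y).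
exists (exist _ x bx); split => // P /nbhs_branchP[n nP].
by apply: filterS (Fag n) => y /nP.
Qed.

(** Compactness provides a cluster point, and a Cauchy sequence converges to any of its cluster
    points. *)
Lemma branch_complete : complete_metric X.
Proof.
move=> u cu; have [x [_ clx]] := [elaborate @branch_compact (u @ \oo) _ filterT].
exists x; apply/cvg_entourageP => E entE.
have : nbhs entourage (split_ent E) by rewrite nbhs_filterE.
move=> /(cu (split_ent E))[] [D1 D2]/= /[!nbhs_simpl] -[FD1 FD2 D1D2E].
have : nbhs x (xsection (split_ent E) x) by exact: nbhs_entourage.
move=> /(clx _ (xsection (split_ent E) x) FD1)[z [Dz /xsectionP Exz]].
by near=> t; apply/(entourage_split z entE Exz)/D1D2E; split => //; near: t.
Unshelve. all: by end_near. Qed.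

End branch_topology.

(** * Stone duality *)

(** An isomorphism of [B] onto the algebra of clopen sets; preservation of join, bounds and order
    follows from that of meet and complement. *)
Definition stone_dual disp (B : ctbDistrLatticeType disp) (X : topologicalType)
    (phi : B -> set X) : Prop :=
  [/\ forall y, clopen (phi y), injective phi,
      forall K, clopen K -> exists y, phi y = K,
      forall y z, phi (y `&` z)%O = phi y `&` phi z
    & forall y, phi (~` y)%O = ~` phi y].

Section dual_theory.
Context {disp : Order.disp_t} {B : ctbDistrLatticeType disp}.
Context {X : topologicalType}.
Variable phi : B -> set X.
Hypothesis dphi : stone_dual phi.

Lemma dual_clopen y : clopen (phi y). Proof. by case: dphi => h. Qed.

Lemma dual_inj : injective phi. Proof. by case: dphi. Qed.

Lemma dual_surj K : clopen K -> exists y, phi y = K.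
Proof. by case: dphi => _ _ + _ _; exact. Qed.

Lemma dualI y z : phi (y `&` z)%O = phi y `&` phi z.
Proof. by case: dphi => _ _ _ h _; exact: h. Qed.

Lemma dualC y : phi (~` y)%O = ~` phi y.
Proof. by case: dphi => _ _ _ _; exact. Qed.

Lemma dualU y z : phi (y `|` z)%O = phi y `|` phi z.
Proof.
by rewrite -[(y `|` z)%O]complK complU dualC dualI !dualC setCI !setCK.
Qed.

Lemma dual0 : phi \bot%O = set0.
Proof. by rewrite -(meetxC (\bot%O : B)) dualI dualC setICr. Qed.

Lemma dual1 : phi \top%O = setT.
Proof. by rewrite -compl0 dualC dual0 setC0. Qed.

Lemma dual_neq0 y : y != \bot%O -> phi y !=set0.
Proof.
by move=> y0; apply/set0P; apply: contra_neq y0; rewrite -dual0 => /dual_inj.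
Qed.

Lemma dual_le y z : (y <= z)%O <-> phi y `<=` phi z.
Proof.
rewrite leEmeet; split => [/eqP <-|/setIidPl yz]; first by rewrite dualI => x [].
by apply/eqP/dual_inj; rewrite dualI.
Qed.

End dual_theory.

(** Binary digits: every finite prefix is realised by some [s], and the digits of each [s] are
    eventually zero. *)
Definition bit (s k : nat) : bool := odd (iter k half s).

Lemma bit_small s k n : (s < 2 ^ n)%N -> (n <= k)%N -> bit s k = false.
Proof.
move=> sn nk; have {nk} sk : (s < 2 ^ k)%N.
  by apply: leq_trans sn _; rewrite leq_exp2l.
rewrite /bit; elim: k s {n sn} sk => [|k IH] s; first by rewrite ltnS leqn0 => /eqP ->.
by rewrite iterSr expnS => sk; apply: IH; lia.
Qed.

Lemma bit_exists (x : nat -> bool) n : exists2 s, (s < 2 ^ n)%N & agree x (bit s) n.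
Proof.
elim: n x => [|n IH] x; first by exists 0%N.
have [s sn xs] := IH (fun i => x i.+1).
exists (x 0%N + s.*2)%N; first by rewrite expnS; case: (x 0%N) => /=; lia.
case=> [_|i]; first by rewrite /bit /= oddD odd_double addbF oddb.
by rewrite ltnS => /xs ->; rewrite /bit iterSr half_bit_double.
Qed.

Section branch_dual.
Variable R : realType.
Context {disp : Order.disp_t} {B : ctbDistrLatticeType disp}.
Variable b : nat -> B.
Hypothesis B_nontrivial : (\top : B)%O != \bot%O.
Local Notation X := (branch_space R b).

Definition branch_of (p : nat -> bool) : X :=
  exist _ (greedy b \top%O p) (greedy_branch b p B_nontrivial).

Lemma branch_of_agree (x : X) p n :
  agree (sval x) p n -> agree (sval x) (sval (branch_of p)) n.
Proof. by move=> xp; apply: greedy_agree => //; exact: (svalP x). Qed.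

Lemma branch_of_dense : dense (range (branch_of \o bit)).
Proof.
move=> O [x Ox] oO; have /nbhs_branchP[n nO] : nbhs x O by exact: open_nbhs_nbhs.
have [s _ xs] := bit_exists (sval x) n.
exists (branch_of (bit s)); split; last by exists s.
by apply: nO; exact: branch_of_agree.
Qed.

Lemma clopen_cylinder (x : X) n : clopen [set y : X | agree (sval x) (sval y) n].
Proof.
split; first rewrite openE; last rewrite -openC openE; move=> y /= xy;
  apply/nbhs_branchP; exists n => z /= yz.
- by move=> i ni; rewrite xy// yz.
- by apply: contra_not xy => xz i ni; rewrite xz// yz.
Qed.

Lemma branch_clopen_basis : clopen_basis X.
Proof.
exists (@clopen X) => //; split=> [K []//|x P /nbhs_branchP[n nP]].
exists [set y : X | agree (sval x) (sval y) n] => //.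
by split => //; exact: clopen_cylinder.
Qed.

Lemma branch_CP0 : CP0 R X.
Proof.
split.
- by exists (branch_of (bit 0)).
- exact: branch_compact.
- exact: branch_clopen_basis.
- split; last first.
    exists (X : metricType R); first exact: branch_complete.
    by exists id, id; split => // x; exact: cvg_id.
  exists (range (branch_of \o bit)); last exact: branch_of_dense.
  exact: card_image_le.
Qed.

Hypothesis b_surj : forall y, exists n, b n = y.

(** A branch stands for the ultrafilter generated by its finite meets; these are the branches whose
    ultrafilter contains [y]. *)
Definition branch_phi (y : B) : set X :=
  [set x | exists n, (bmeets b (sval x) n <= y)%O].

Lemma branch_phi_b n : branch_phi (b n) = [set x : X | sval x n].
Proof.
apply/seteqP; split => x /=.
  move=> [m xm]; apply/negPn/negP => xn.
  have := svalP x (maxn m n.+1); rewrite -lex0 => /negP; apply.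
  rewrite -(meetxC (b n)) lexI (le_trans _ xm) ?bmeets_le ?leq_maxl//=.
  have := @bmeets_lit _ _ b (sval x) n (maxn m n.+1).
  by rewrite leq_maxr (negbTE xn) => /(_ isT).
move=> xn; exists n.+1.
by have := @bmeets_lit _ _ b (sval x) n n.+1 (ltnSn _); rewrite xn.
Qed.

Lemma branch_phiC y : branch_phi (~` y)%O = ~` branch_phi y.
Proof.
have [n <-] := b_surj y; rewrite branch_phi_b; apply/seteqP; split => x /=.
  move=> [m xm] xn; have := svalP x (maxn m n.+1); rewrite -lex0 => /negP; apply.
  rewrite -(meetCx (b n)) lexI (le_trans _ xm) ?bmeets_le ?leq_maxl//=.
  have := @bmeets_lit _ _ b (sval x) n (maxn m n.+1).
  by rewrite leq_maxr xn => /(_ isT).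
move=> /negP xn; exists n.+1.
by have := @bmeets_lit _ _ b (sval x) n n.+1 (ltnSn _); rewrite (negbTE xn).
Qed.

Lemma branch_phi_clopen y : clopen (branch_phi y).
Proof. by have [n <-] := b_surj y; rewrite branch_phi_b; exact: clopen_coord. Qed.

Lemma branch_phiI y z : branch_phi (y `&` z)%O = branch_phi y `&` branch_phi z.
Proof.
apply/seteqP; split => x /=.
  by move=> [n]; rewrite lexI => /andP[xy xz]; split; exists n.
move=> [[m xy] [n xz]]; exists (maxn m n); rewrite lexI.
by rewrite (le_trans _ xy) ?(le_trans _ xz)// bmeets_le ?leq_maxl ?leq_maxr.
Qed.

(** The branch grown from [y] stays below [y], so at an index of [y] the digit [true] leaves the
    meet unchanged and is kept. *)
Lemma branch_phi_neq0 y : y != \bot%O -> branch_phi y !=set0.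
Proof.
move=> y0; have [n yn] := b_surj y.
have := branch_phi_b n; rewrite yn => ->.
exists (exist _ _ (greedy_branch b (fun=> true) y0)); rewrite /= /greedy /= yn.
have -> : (gst b y (fun=> true) n `&` y)%O = gst b y (fun=> true) n.
  by apply/meet_idPl; rewrite gstE leIl.
by rewrite gst_neq0.
Qed.

Lemma branch_phi_inj : injective branch_phi.
Proof.
suff h y z : branch_phi y = branch_phi z -> (y <= z)%O.
  by move=> y z yz; apply/eqP; rewrite eq_le !h.
move=> yz; rewrite -[z]complK -disj_leC; apply/negPn/negP => /branch_phi_neq0.
by rewrite branch_phiI branch_phiC yz setICr => -[].
Qed.

Lemma branch_phi_surj K : clopen K -> exists y, branch_phi y = K.
Proof.
move=> [oK cK].
have phiU y z : branch_phi (y `|` z)%O = branch_phi y `|` branch_phi z.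
  rewrite -[(y `|` z)%O]complK complU branch_phiC branch_phiI.
  by rewrite !branch_phiC setCI !setCK.
have phi0 : branch_phi \bot%O = set0.
  by rewrite -(meetxC (\bot%O : B)) branch_phiI branch_phiC setICr.
(* Compactness as a near-covering property: what holds near each point for all large [n] holds at
   all points for one [n]. Here [n] bounds the indices of the basic sets needed to fill [K]. *)
pose P n (x : X) := K x ->
  exists i, [/\ (i < n)%N, branch_phi (b i) `<=` K & branch_phi (b i) x].
have /compact_near_coveringP/(_ _ \oo P) := @branch_compact R _ _ b.
move=> /(_ _ _)[x _|].
  have [Kx|nKx] := pselect (K x); last first.
    have : nbhs x (~` K) by apply: open_nbhs_nbhs; split => //; exact: closed_openC.
    move=> h; exists (~` K, setT); first by split => //; exact: filterT.
    by move=> [z n] [/= nKz _].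
  have /nbhs_branchP[n nK] : nbhs x K by exact: open_nbhs_nbhs.
  have [i bi] := b_surj (bmeets b (sval x) n).
  exists (branch_phi (b i), [set m | (i < m)%N]).
    split; last by exists i.+1.
    apply: open_nbhs_nbhs; split; first by case: (branch_phi_clopen (b i)).
    by exists n; rewrite bi.
  move=> [z m] [/= bz im] Kz; exists i; split => // t; rewrite bi => -[k tk].
  (* A branch [t] in the set of this finite meet agrees with [x] below [n]: otherwise a finite meet
     of [t] would lie below a literal and its complement. *)
  apply: nK; move=> j jn; apply/eqP/negPn/negP => xtj.
  have := svalP t (maxn k j.+1); rewrite -lex0 => /negP; apply.
  rewrite -(meetxC (lit b j (sval x j))) lexI -litN.
  have -> : ~~ sval x j = sval t j by move: xtj; case: (sval x j); case: (sval t j).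
  rewrite bmeets_lit ?leq_maxr// andbT (le_trans (bmeets_le _ _ (leq_maxl k _)))//.
  by rewrite (le_trans tk)// bmeets_lit.
move=> N _ /(_ N (leqnn N)) hN.
(* The element sought is the join of those [b i] with [i < N] whose sets lie inside [K]. *)
have [y hy] : exists y, branch_phi y =
    [set x | exists i, [/\ (i < N)%N, branch_phi (b i) `<=` K & branch_phi (b i) x]].
  elim: {P hN} N => [|N [y hy]].
    by exists \bot%O; rewrite phi0; apply/seteqP; split => // x [i []].
  have [bK|nbK] := pselect (branch_phi (b N) `<=` K).
    exists (y `|` b N)%O; rewrite phiU hy; apply/seteqP; split => x /=.
      move=> [[i [iN iK ix]]|bx]; last by exists N.
      by exists i; rewrite ltnS (ltnW iN).
    move=> [i []]; rewrite ltnS leq_eqVlt => /predU1P[->|iN] iK ix; first by right.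
    by left; exists i.
  exists y; rewrite hy; apply/seteqP.
  split => x /= -[i [iN iK ix]]; exists i; split => //.
    exact: ltnW.
  by move: iN; rewrite ltnS leq_eqVlt => /predU1P[iN|//]; rewrite iN in iK.
exists y; rewrite hy; apply/seteqP; split => x; last exact: hN.
by move=> [i [_ + ]]; exact.
Qed.

Lemma branch_dual : stone_dual branch_phi.
Proof.
split; [exact: branch_phi_clopen | exact: branch_phi_inj | exact: branch_phi_surj |
  exact: branch_phiI | exact: branch_phiC].
Qed.

End branch_dual.

(** * Uniqueness of the dual space up to homeomorphism *)

Section dual_homeomorphism.
Variable R : realType.
Context {disp : Order.disp_t} {B : ctbDistrLatticeType disp}.
Variables (b : nat -> B) (X : topologicalType) (phi : B -> set X).
Hypothesis b_surj : forall y, exists n, b n = y.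
Hypothesis dphi : stone_dual phi.
Hypotheses (cX : compact [set: X]) (zX : clopen_basis X).
Hypothesis hX : exists M : metricType R, homeomorphic M X.

Lemma clopen_nbhs (x : X) (P : set X) : nbhs x P ->
  exists n, phi (b n) x /\ phi (b n) `<=` P.
Proof.
have [D [oD bD] cD] := zX; move=> /(bD x)[K [DK Kx] KP].
have [y yK] := dual_surj dphi (cD _ DK); have [n ny] := b_surj y.
by exists n; rewrite ny yK.
Qed.

(** The homeomorphic metric space supplies an open set around one of two distinct points that misses
    the other; a clopen set fits inside it. *)
Lemma clopen_separates (x y : X) : (forall n, phi (b n) x -> phi (b n) y) -> x = y.
Proof.
move=> xy; have [M [f [g [fg gf _ cg]]]] := hX.
rewrite -[x]gf -[y]gf; congr f; apply: contrapT => /eqP gxy.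
have [U [oU]] := hausdorff_accessible (@metric_hausdorff _ M) gxy.
rewrite !inE => Ux Uy.
have /cg : nbhs (g x) U by exact: open_nbhs_nbhs.
by move=> /clopen_nbhs[n [/xy ny nU]]; apply: Uy; exact: nU.
Qed.

Lemma nbhs_phi y x : phi y x -> nbhs x (phi y).
Proof.
by move=> yx; apply: open_nbhs_nbhs; split => //; case: (dual_clopen dphi y).
Qed.

Definition coords (x : X) (n : nat) : bool := `[< phi (b n) x >].

Lemma phi_lit x n c : phi (lit b n c) x <-> coords x n = c.
Proof.
rewrite /lit /coords; case: c; rewrite ?dualC//; first by split => /asboolP.
by split; [move/asboolPn/negbTE | move=> h; apply/asboolPn/negbT].
Qed.

Lemma phi_bmeets x (c : nat -> bool) n : phi (bmeets b c n) x <-> agree (coords x) c n.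
Proof.
elim: n => [|n IH] /=; first by rewrite dual1.
rewrite dualI//; split => [[/IH h /phi_lit e] i|h].
  by rewrite ltnS leq_eqVlt => /predU1P[->|/h].
by split; [apply/IH => i ni; apply/h/ltnW | apply/phi_lit/h].
Qed.

Lemma coords_branch x : branch b (coords x).
Proof.
move=> n; apply/eqP => e.
have : phi (bmeets b (coords x) n) x by apply/phi_bmeets.
by rewrite e dual0.
Qed.

(** If every point differed from [c] somewhere, compactness would bound the place of the difference
    by some [N]; but the meet of length [N] along [c] is nonzero, so its clopen set has a point. *)
Lemma coords_onto (c : nat -> bool) : branch b c -> exists x, coords x = c.
Proof.
move=> bc; apply: contrapT => h.
pose P n (x : X) := ~ agree (coords x) c n.
have /compact_near_coveringP/(_ _ \oo P) := cX.
move=> /(_ _ _)[x _|N _ /(_ N (leqnn N)) hN].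
  have /fdiff_ex[k ck] : coords x <> c by move=> e; apply: h; exists x.
  have xk : phi (lit b k (coords x k)) x by exact/phi_lit.
  exists (phi (lit b k (coords x k)), [set n | (k < n)%N]).
    by split; [exact: nbhs_phi | exists k.+1].
  move=> [y n] [/= /phi_lit yk kn] /(_ k kn) /eqP.
  by rewrite yk (negbTE ck).
by have [x /phi_bmeets /hN] := dual_neq0 dphi (bc N); exact.
Qed.

(** Single coordinates correspond to the sets [phi (b n)], cylinders to the sets of finite meets;
    this gives continuity in both directions. *)
Lemma dual_homeomorphic : homeomorphic (branch_space R b) X.
Proof.
pose g x : branch_space R b := exist _ (coords x) (coords_branch x).
have gI : injective g.
  move=> x y [xy]; apply: clopen_separates => n /asboolP.
  by rewrite -/(coords x n) xy => /asboolP.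
have /choice[f fP] : forall m, exists x, g x = m.
  move=> m; have [x xm] := coords_onto (svalP m).
  by exists x; exact: branch_space_eq.
exists f, g; split=> [//|x|m P|x P].
- by apply: gI; rewrite fP.
- move=> /clopen_nbhs[n [nm nP]]; apply/nbhs_branchP; exists n.+1 => m' mm'.
  apply: nP; apply/asboolP; rewrite -[asbool _]/(sval (g (f m')) n) fP -mm'//.
  by rewrite -{1}(fP m); apply/asboolP.
- move=> /nbhs_branchP[n nP].
  have : nbhs x (phi (bmeets b (coords x) n)) by apply/nbhs_phi/phi_bmeets.
  apply: filterS => y /phi_bmeets yx; apply: nP => i ni /=.
  by rewrite yx.
Qed.

End dual_homeomorphism.

(** * Turing degrees *)

Lemma recursive_in_trans (A C : nat -> bool) n (f : n.-tuple nat -> nat) :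
  turing_le A C -> recursive_in A f -> recursive_in C f.
Proof.
move=> AC; elim=> {n f}.
- exact: rec_zero.
- exact: rec_succ.
- exact: rec_proj.
- exact: AC.
- by move=> m n f g h _ hf _ hg fg; exact: (rec_comp hf hg fg).
- by move=> n f g h _ hf _ hg h0 hS; exact: (rec_prim hf hg h0 hS).
- by move=> n f h _ hf hh; exact: (rec_min hf hh).
Qed.

Lemma turing_le_refl A : turing_le A A.
Proof. exact: rec_oracle. Qed.

(** [computable d] may use a different member of the degree for each function; one fixed oracle
    allows functions to be combined. *)
Lemma degree_oracle (d : turing_degree) : exists A, forall n (f : n.-tuple nat -> nat),
  computable d f <-> recursive_in A f.
Proof.
have [A dA] := degree_classP d; exists A => n f; split => [[C dC Cf]|Af].
  by move: dC; rewrite dA => -[_ CA]; exact: recursive_in_trans Cf.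
by exists A => //; rewrite dA; split; exact: turing_le_refl.
Qed.

Lemma Rec_unary A (f : nat -> nat) :
  recursive_in A (unary f) <-> Rec A (fun v : ctx 1 => f v.1).
Proof.
rewrite /Rec /=; suff -> : unary f = fun v : 1.-tuple nat => f (nth 0%N v 0) by [].
by apply/funext => v; rewrite /unary /thead (tnth_nth 0%N).
Qed.

Lemma Rec_binary A (f : nat -> nat -> nat) :
  recursive_in A (binary f) <-> Rec A (fun v : ctx 2 => f v.1 v.2.1).
Proof.
rewrite /Rec /=.
suff -> : binary f = fun v : 2.-tuple nat => f (nth 0%N v 0) (nth 0%N v 1) by [].
by apply/funext => v; rewrite /binary !(tnth_nth 0%N).
Qed.

Lemma Rec_ternary A (f : 3.-tuple nat -> nat) :
  recursive_in A f <-> Rec A (fun v : ctx 3 => f [tuple v.1; v.2.1; v.2.2.1]).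
Proof.
rewrite /Rec /=; set g := (X in _ <-> recursive_in A X); suff -> : g = f by [].
apply/funext => v; rewrite /g; congr f; apply: eq_from_tnth => i.
rewrite !(tnth_nth 0%N); case: i => -[|[|[|]]] //.
Qed.

(** * From a Boolean algebra to a compact presentation *)

Section branch_presentation.
Variables (R : realType) (A : nat -> bool).
Context {disp : Order.disp_t} {B : ctbDistrLatticeType disp}.
Variable b : nat -> B.
Hypothesis B_nontrivial : (\top : B)%O != \bot%O.
Local Notation X := (branch_space R b).

Definition pt (s k : nat) : bool := greedy b \top%O (bit s) k.

Hypothesis hpt : Rec A (fun v : ctx 2 => nat_of_bool (pt v.1 v.2.1)).

Definition bpt (s : nat) : X := @branch_of R _ _ b B_nontrivial (bit s).

Lemma sval_bpt s : sval (bpt s) = pt s. Proof. by []. Qed.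

(** The bound [s + t] suffices: both numbers are below 2^(s + t), so from there on all digits vanish
    and [greedy_eq] applies. *)
Definition pteq (s t : nat) : bool := ballb (s + t) (fun k => pt s k == pt t k).

Lemma pteqP s t : reflect (bpt s = bpt t) (pteq s t).
Proof.
apply: (iffP (ballbP _ _)) => [h|h k _].
  apply: branch_space_eq; apply/funext; apply: (@greedy_eq _ _ _ _ _ (s + t)).
    move=> k stk; rewrite !(@bit_small _ _ (s + t))//.
      by rewrite (leq_ltn_trans (leq_addl s t))// ltn_expl.
    by rewrite (leq_ltn_trans (leq_addr t s))// ltn_expl.
  by move=> k /h/eqP.
by rewrite -!sval_bpt h.
Qed.

Definition newpt (t : nat) : bool := ballb t (fun s => ~~ pteq s t).

Lemma Rec_newpt : Rec A (fun v : ctx 1 => nat_of_bool (newpt v.1)).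
Proof. by rewrite /newpt /pteq; rec_tac. Qed.

Lemma newpt_exists t : exists2 s, newpt s & bpt s = bpt t /\ (s <= t)%N.
Proof.
have [h1 h2] := muP (ex_intro (pteq ^~ t) t (introT (pteqP t t) erefl)).
exists (mu (pteq ^~ t)); last by split; [exact/pteqP | apply/h2/pteqP].
apply/ballbP => s sm; apply/negP => /pteqP sE.
suff /h2 : pteq s t by rewrite leqNgt sm.
by apply/pteqP; rewrite sE; exact/pteqP.
Qed.

(** Finitely many new indices would make the range of [bpt] finite, hence closed, and being dense it
    would be the whole space. *)
Lemma newpt_unbounded :
  infinite_set [set: X] -> forall n, exists t, (n < t)%N && newpt t.
Proof.
move=> infX n; apply: contrapT => h; apply: infX.
have fr : finite_set (range bpt).
  apply: (@sub_finite_set _ _ (bpt @` `I_n.+1)); last exact/finite_image/finite_II.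
  move=> _ [t _ <-]; have [s ns [st _]] := newpt_exists t; exists s => //=.
  by rewrite ltnS leqNgt; apply/negP => sn; apply: h; exists s; rewrite sn.
suff <- : range bpt = setT by [].
have /accessible_finite_set_closed/(_ _ fr) cr : accessible_space X.
  exact/hausdorff_accessible/metric_hausdorff.
apply/seteqP; split => // x _; apply: contrapT => nx.
have [y [ny [s _ sy]]] : ~` range bpt `&` range bpt !=set0; last by apply: ny; exists s.
by apply: branch_of_dense; [exists x | exact: closed_openC].
Qed.

Definition next (n : nat) : nat := mu (fun t => (n < t)%N && newpt t).

(** In an infinite space the least indices of the points are enumerated in increasing order, which
    removes repetitions; in a finite space repetitions are allowed and [e] is the identity. *)
Lemma enum_points : exists e : nat -> nat,
  [/\ Rec A (fun v : ctx 1 => e v.1), range (bpt \o e) = range bpt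
    & infinite_set [set: X] -> injective (bpt \o e)].
Proof.
have [infX|finX] := pselect (infinite_set [set: X]); last first.
  by exists id; split => //; exact: Rec_var0.
have nex := newpt_unbounded infX.
have nextP n : (n < next n)%N /\ newpt (next n).
  by have [/andP[]] := muP (nex n).
have next_le n t : (n < t)%N -> newpt t -> (next n <= t)%N.
  by move=> nt tn; have [_] := muP (nex n); apply; rewrite nt.
pose e n := iter n next 0%N.
have e_new n : newpt (e n).
  by case: n => [|n] /=; [exact/ballbP | case: (nextP (e n))].
have e_lt m n : (m < n)%N -> (e m < e n)%N.
  elim: n => // n IH; rewrite ltnS leq_eqVlt => /predU1P[->|/IH].
    by case: (nextP (e n)).
  by move=> h; apply: ltn_trans h _; case: (nextP (e n)).
have e_onto n t : newpt t -> (t <= e n)%N -> exists m, e m = t.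
  move=> nt; elim: n => [|n IH]; first by rewrite leqn0 => /eqP ->; exists 0%N.
  have [/IH//|ent] := leqP t (e n).
  rewrite leq_eqVlt => /predU1P[->|h]; first by exists n.+1.
  by have := next_le _ _ ent nt; rewrite leqNgt h.
have e_ge n : (n <= e n)%N.
  by elim: n => // n IH; apply: leq_ltn_trans IH _; case: (nextP (e n)).
have hn : Rec A (fun v : ctx 1 => next v.1).
  by have hnew := Rec_newpt; rewrite /next; rec_tac => v; exact: nex.
exists e; split; first by rewrite /e; rec_tac.
- apply/seteqP; split => _ [n _ <-]; first by exists (e n).
  have [s ns [<- _]] := newpt_exists n; have [m <-] := e_onto s s ns (e_ge s).
  by exists m.
- move=> _ m n mn; case: (ltngtP m n) => // /e_lt lt.
  + by have /ballbP/(_ _ lt)/negP := e_new n; case; exact/pteqP.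
  + by have /ballbP/(_ _ lt)/negP := e_new m; case; exact/pteqP/esym.
Qed.

Variable e : nat -> nat.
Hypothesis he : Rec A (fun v : ctx 1 => e v.1).

Definition brho (i j : nat) : R := mdist (bpt (e i)) (bpt (e j)).

(** The cut at [k] makes the search stop even for equal points; precision 2^-k asks for no more. *)
Definition fdiff (i j k : nat) : nat :=
  mu (fun n => (n == k) || (pt (e i) n != pt (e j) n)).

Lemma fdiff_total i j k : exists n, (n == k) || (pt (e i) n != pt (e j) n).
Proof. by exists k; rewrite eqxx. Qed.

Lemma Rec_fdiff : Rec A (fun v : ctx 3 => fdiff v.1 v.2.1 v.2.2.1).
Proof. by rewrite /fdiff; rec_tac => v; exact: fdiff_total. Qed.

Lemma brho_computable : exists p q s : 3.-tuple nat -> nat,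
  [/\ recursive_in A p, recursive_in A q, recursive_in A s
    & forall i j k : nat, let v := [tuple i; j; k] in
      `| brho i j - ((p v)%:R - (q v)%:R) / (s v).+1%:R | <= 2^-1 ^+ k].
Proof.
have hf := Rec_fdiff.
pose F (v : 3.-tuple nat) := fdiff (tnth v ord0) (tnth v (inord 1)) (tnth v (inord 2)).
have FE i j k : F [tuple i; j; k] = fdiff i j k.
  by rewrite /F !(tnth_nth 0%N) /= !inordK.
(* If a difference is found before [k], the fraction is the exact distance 2^-F; otherwise the
   distance is at most 2^-k and the approximation is 0. The predecessor offsets the successor in the
   denominator. *)
exists (fun v => nat_of_bool (F v != tnth v (inord 2))), (fun=> 0%N),
  (fun v => (2 ^ F v).-1); split.
- apply/Rec_ternary.
  have -> : (fun v : ctx 3 => nat_of_bool (F [tuple v.1; v.2.1; v.2.2.1] !=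
      tnth [tuple v.1; v.2.1; v.2.2.1] (inord 2))) =
      (fun v => nat_of_bool (fdiff v.1 v.2.1 v.2.2.1 != v.2.2.1)).
    by apply/funext => v; rewrite FE (tnth_nth 0%N) /= inordK.
  by rec_tac.
- exact: rec_zero.
- apply/Rec_ternary.
  have -> : (fun v : ctx 3 => (2 ^ F [tuple v.1; v.2.1; v.2.2.1]).-1) =
      (fun v => (2 ^ fdiff v.1 v.2.1 v.2.2.1).-1).
    by apply/funext => v; rewrite FE.
  by rec_tac.
- move=> i j k; cbv zeta; rewrite FE (tnth_nth 0%N) /= inordK//= subr0.
  have [h1 h2] := muP (fdiff_total i j k); rewrite -/(fdiff i j k) in h1 h2.
  have ag : agree (pt (e i)) (pt (e j)) (fdiff i j k).
    move=> n nf; apply/eqP/negPn/negP => d.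
    by have := h2 n; rewrite d orbT leqNgt nf => /(_ isT).
  have [fk|fk] /= := eqVneq (fdiff i j k) k.
    rewrite mul0r subr0 /brho ger0_norm ?mdist_ge0// mdist_branchE.
    by apply/bdist_le; rewrite -[n in agree _ _ n]fk.
  rewrite prednK ?expn_gt0// div1r natrX -exprVn.
  have neq : pt (e i) (fdiff i j k) != pt (e j) (fdiff i j k).
    by move: h1; rewrite (negbTE fk).
  suff -> : brho i j = 2^-1 ^+ fdiff i j k by rewrite subrr normr0 ltW// half_exp_gt0.
  apply/eqP; rewrite eq_le /brho mdist_branchE bdist_ge// andbT.
  exact/bdist_le.
Qed.

Definition halflt (k p q c : nat) : bool := (c.+1 + q * 2 ^ k < p * 2 ^ k)%N.

Lemma halfltP k p q c :
  halflt k p q c = (2^-1 ^+ k < ratr ((p%:R - q%:R) / c.+1%:R) :> R).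
Proof.
rewrite rmorphM /= fmorphV /= rmorphB /= !ratr_nat ltr_pdivlMr ?ltr0n//.
rewrite exprVn mulrC ltr_pdivrMr ?exprn_gt0// mulrBl ltrBrDr.
by rewrite -!natrX -!natrM -natrD ltr_nat.
Qed.

(** A decidable condition ensuring that the ball coded by [w] contains the whole cylinder of length
    [n] around point [s]. *)
Definition ball_near (n s w : nat) : bool :=
  bexb n.+1 (fun k => halflt k (nthc w 1) (nthc w 2) (nthc w 3) &&
    ballb k (fun j => pt s j == pt (e (nthc w 0)) j)).

Definition covers_at (E n : nat) : bool :=
  ballb (2 ^ n) (fun s => bexb (sizec E) (fun l => ball_near n s (nthc E l))).

Lemma Rec_covers_at : Rec A (fun v : ctx 2 => nat_of_bool (covers_at v.1 v.2.1)).
Proof.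
have h : Rec A (fun v : ctx 3 => nat_of_bool (ball_near v.1 v.2.1 v.2.2.1)).
  by rewrite /ball_near /halflt; rec_tac.
by rewrite /covers_at; rec_tac.
Qed.

Lemma ball_of_codeE w :
  ball_of_code w = (nthc w 0, ((nthc w 1)%:R - (nthc w 2)%:R) / (nthc w 3).+1%:R).
Proof. by rewrite /ball_of_code !nthcE. Qed.

Lemma finset_of_codeP E c :
  reflect (exists2 l, (l < sizec E)%N & c = ball_of_code (nthc E l))
    (c \in finset_of_code E).
Proof.
apply: (iffP (nthP (0%N, 0%Q))) => -[l]; rewrite size_map -sizecE => lE.
  by rewrite (nth_map 0%N) -?sizecE// -nthcE => <-; exists l.
by move=> ->; exists l => //; rewrite (nth_map 0%N) -?sizecE// -nthcE.
Qed.

(** The first 2^n points meet every cylinder of length [n], which gives soundness. Conversely, take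
    2^-n below all positive radii in [E]: a point in a ball agrees with its centre up to [n], or
    first differs at some k <= n, where 2^-k is the distance itself. *)
Lemma covers_atP E : cover_codes (bpt \o e) E <-> exists n, covers_at E n.
Proof.
split=> [cov|[n /ballbP cov] x]; last first.
  have [s sn xs] := bit_exists (sval x) n.
  have /bexbP[l lE /bexbP[k kn /andP[]]] := cov s sn.
  rewrite halfltP => kr /ballbP ag.
  exists (ball_of_code (nthc E l)); first by apply/finset_of_codeP; exists l.
  rewrite ball_of_codeE /=; apply: le_lt_trans kr.
  apply/bdist_le => i ik.
  by rewrite (branch_of_agree B_nontrivial xs) ?(leq_trans ik)//; exact/eqP/ag.
have [n hn] : exists n, forall c, c \in finset_of_code E -> 0 < ratr c.2 :> R ->
    2^-1 ^+ n < ratr c.2 :> R.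
  elim: (finset_of_code E) => [|c s [n hn]]; first by exists 0%N.
  have [c0|c0] := ltP 0 (ratr c.2 : R); last first.
    by exists n => c'; rewrite inE => /predU1P[->|/hn//]; rewrite ltNge c0.
  have [m mc] := half_exp_lt c0; exists (maxn m n) => c'.
  rewrite inE => /predU1P[-> _|cs c'0].
    by apply: le_lt_trans mc; rewrite half_exp_le leq_maxl.
  by apply: le_lt_trans (hn _ cs c'0); rewrite half_exp_le leq_maxr.
exists n; apply/ballbP => s _.
have [c cE lt] := cov (bpt s); move/finset_of_codeP: (cE) => [l lE cl].
apply/bexbP; exists l => //.
have c0 : 0 < ratr c.2 :> R by apply: le_lt_trans lt; exact: mdist_ge0.
have {hn} := hn _ cE c0.
rewrite {c cE c0}cl in lt *; move: lt; rewrite ball_of_codeE /= => lt hn.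
have [same|diff] := pselect (agree (pt s) (pt (e (nthc (nthc E l) 0))) n).
  apply/bexbP; exists n => //; rewrite halfltP hn /=; apply/ballbP => j jn.
  exact/eqP/same.
have neq : pt s <> pt (e (nthc (nthc E l) 0)) by move=> h; apply: diff; rewrite h.
have [k [dk nk ag]] := bdist_neq R neq.
apply/bexbP; exists k.
  rewrite ltnS leqNgt; apply/negP => nk'; apply: diff => i ni; apply: ag.
  exact: ltn_trans nk'.
rewrite halfltP -dk lt /=; apply/ballbP => j jk; exact/eqP/ag.
Qed.

Lemma cover_codes_ce : exists2 f : nat -> nat, recursive_in A (unary f)
  & cover_codes (bpt \o e) = range f.
Proof.
(* The default value of the enumeration: one ball of radius 2, which is everything because distances
   are at most 1. *)
have [c cE] := decode_onto [:: 0; 2; 0; 0]%N; have [w wE] := decode_onto [:: c].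
have cw : cover_codes (bpt \o e) w.
  move=> x; exists (ball_of_code c); first by rewrite /finset_of_code wE inE.
  rewrite /ball_of_code cE /= subr0 divr1 ratr_nat.
  apply: (@le_lt_trans _ _ (2^-1 ^+ 0)); last by rewrite expr0 ltr1n.
  exact/bdist_le.
exists (fun m => if covers_at (nthc m 0) (nthc m 1) then nthc m 0 else w).
  by apply/Rec_unary; have h := Rec_covers_at; rec_tac.
apply/seteqP; split => [E /covers_atP[n En]|_ [m _ <-]].
  by exists (CodeSeq.code [:: E; n]) => //; rewrite !nthcE CodeSeq.codeK /= En.
by case: ifP => // h; apply/covers_atP; exists (nthc m 1).
Qed.

End branch_presentation.

Lemma presentation_of_copy (R : realType) disp (B : ctbDistrLatticeType disp)
    (X : topologicalType) (phi : B -> set X) (d : turing_degree) :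
  stone_dual phi -> CP0 R X -> has_computable_copy B d ->
  has_computable_compact_presentation R X d.
Proof.
move=> dphi [[x0 _] cX zX [_ [M0 _ hM0]]].
move=> [U [meet [join [compl [h [[hU hm _ hc] [hI hr] hmE _ hcE]]]]]].
have [A hA] := degree_oracle d.
move: hU hm hc => /hA/Rec_unary hU /hA/Rec_binary hm /hA/Rec_unary hc.
have nt : (\top : B)%O != \bot%O.
  apply/eqP => e; have : phi \top%O x0 by rewrite (dual1 dphi).
  by rewrite e (dual0 dphi).
(* Numbers outside the universe are made to name the bottom, so that [b] is defined on all of [nat];
   [z] also serves for testing whether a meet is zero. *)
pose z := h \bot%O; pose u n := if U n then n else z.
have /choice[b hb] : forall n, exists y, h y = u n.
  move=> n; rewrite /u; case: ifP => Un; last by exists \bot%O.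
  by have : range h n by [rewrite hr]; case=> y _ <-; exists y.
have b_surj y : exists n, b n = y.
  exists (h y); apply: hI; rewrite hb /u.
  by have : range h (h y) by [exists y]; rewrite hr /= => ->.
pose lt1 s k := if bit s k then u k else compl (u k).
pose lt0 s k := if bit s k then compl (u k) else u k.
have lt1E s k : h (lit b k (bit s k)) = lt1 s k.
  by rewrite /lt1 /lit; case: ifP => _; rewrite ?hcE hb.
have lt0E s k : h (lit b k (~~ bit s k)) = lt0 s k.
  by rewrite /lt0 /lit; case: (bit s k) => /=; rewrite ?hcE hb.
have h0 y : (y != \bot%O) = (h y != z) by rewrite (inj_eq hI).
pose step s k r := if meet r (lt1 s k) != z then meet r (lt1 s k) else meet r (lt0 s k).
have gstE s k : h (gst b \top%O (bit s) k) = prec (h \top%O) (step s) k.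
  elim: k => //= k <-; rewrite h0 /step -lt1E -lt0E -!hmE.
  by case: ifP.
have ptE s k : pt b s k =
    if meet (prec (h \top%O) (step s) k) (lt1 s k) != z then bit s k else ~~ bit s k.
  by rewrite /pt /greedy h0 hmE gstE lt1E.
have hbit : Rec A (fun v : ctx 2 => nat_of_bool (bit v.1 v.2.1)).
  by rewrite /bit; rec_tac.
have hu : Rec A (fun v : ctx 1 => u v.1) by rewrite /u; rec_tac.
have hlt1 : Rec A (fun v : ctx 2 => lt1 v.1 v.2.1) by rewrite /lt1; rec_tac.
have hlt0 : Rec A (fun v : ctx 2 => lt0 v.1 v.2.1) by rewrite /lt0; rec_tac.
have hstep : Rec A (fun v : ctx 3 => step v.1 v.2.1 v.2.2.1) by rewrite /step; rec_tac.
have hpt : Rec A (fun v : ctx 2 => nat_of_bool (pt b v.1 v.2.1)).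
  have -> : (fun v : ctx 2 => nat_of_bool (pt b v.1 v.2.1)) = fun v => nat_of_bool
      (if meet (prec (h \top%O) (step v.1) v.2.1) (lt1 v.1 v.2.1) != z
       then bit v.1 v.2.1 else ~~ bit v.1 v.2.1).
    by apply/funext => v; rewrite ptE.
  by rec_tac.
have homeo : homeomorphic (branch_space R b) X.
  by apply: (dual_homeomorphic b_surj dphi) => //; exists M0.
have [e [he re ie]] := enum_points R nt hpt.
exists (brho R b nt e), (branch_space R b), (bpt R b nt \o e); split.
- have pseudo : pseudometric_on_nat (brho R b nt e).
    split=> [i|i j|i j k]; [exact: mdistxx|exact: metric_sym|exact: metric_triangle].
  split=> //.
  + move=> infX; split=> // i j /mdist_positivity ij; apply: ie ij => finM; apply: infX.
    have [f [g [fg gf _ _]]] := homeo.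
    have -> : [set: X] = f @` setT by apply/seteqP; split => // x _; exists (g x).
    exact: finite_image.
  + split; [exact: branch_complete | rewrite re; exact: branch_of_dense | by []].
- have [p [q [s [hp hq hs pqs]]]] := brho_computable R nt hpt he.
  by exists p, q, s; split => //; apply/hA.
- right; have [f hf fE] := cover_codes_ce R nt hpt he.
  by exists f => //; apply/hA.
Qed.

(** * From a compact presentation to a Boolean algebra *)

Section decidable_copy.
Variable A : nat -> bool.
Context {disp : Order.disp_t} {B : ctbDistrLatticeType disp}.
Variables (b : nat -> B) (Q : nat -> nat -> nat -> nat -> bool).
Hypothesis b_surj : forall y, exists n, b n = y.
Hypothesis hQ : Rec A (fun v : ctx 4 => nat_of_bool (Q v.1 v.2.1 v.2.2.1 v.2.2.2.1)).
Hypothesis QE : forall i l j k, Q i l j k = (b i `&` b l <= b j `|` b k)%O.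

Let lec i j := Q i i j j.
Let lecE i j : lec i j = (b i <= b j)%O.
Proof. by rewrite /lec QE meetxx joinxx. Qed.

(** The universe consists of the least index of each element. With two elements on each side, [Q]
    states that [k] is a lower bound of [m], [n] above their meet, dually for the join, and that [k]
    and [n] are disjoint with join the top; each operation is then found by search. *)
Lemma copy_of_decidable (d : turing_degree) :
  (forall n (f : n.-tuple nat -> nat), recursive_in A f -> computable d f) ->
  has_computable_copy B d.
Proof.
move=> hd; have [z zE] := b_surj \bot%O; have [u uE] := b_surj \top%O.
have hle : Rec A (fun v : ctx 2 => nat_of_bool (lec v.1 v.2.1)).
  by rewrite /lec; rec_tac.
have h_ex y : exists n, b n == y.
  by have [n <-] := b_surj y; exists n.
pose h y := mu (fun n => b n == y).
have hK y : b (h y) = y.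
  by have [/eqP] := muP (h_ex y).
pose U n := ballb n (fun m => ~~ (lec m n && lec n m)).
pose meet m n := mu (fun k => [&& lec k m, lec k n & Q m n k k]).
pose join m n := mu (fun k => [&& Q k k m n, lec m k & lec n k]).
pose compl n := mu (fun k => Q k n z z && Q u u k n).
have meetP m n k : [&& lec k m, lec k n & Q m n k k] = (b k == (b m `&` b n)%O).
  by rewrite !lecE QE joinxx andbA -lexI eq_le.
have joinP m n k : [&& Q k k m n, lec m k & lec n k] = (b k == (b m `|` b n)%O).
  by rewrite !lecE QE meetxx -leUx eq_le.
have complP n k : Q k n z z && Q u u k n = (b k == (~` b n)%O).
  rewrite !QE joinxx meetxx zE uE lex0 disj_leC eq_le; congr andb.
  rewrite le1x -[b k in RHS]complK -disj_leC -complU joinC.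
  by rewrite -compl1 (inj_eq (can_inj (@complK _ B))).
exists U, meet, join, compl, h; split.
- split; apply: hd; [apply/Rec_unary|apply/Rec_binary|apply/Rec_binary|apply/Rec_unary].
  + by rewrite /U; rec_tac.
  + rewrite /meet; rec_tac => v; have [k kE] := b_surj (b v.1 `&` b v.2.1)%O.
    by exists k; rewrite meetP kE.
  + rewrite /join; rec_tac => v; have [k kE] := b_surj (b v.1 `|` b v.2.1)%O.
    by exists k; rewrite joinP kE.
  + rewrite /compl; rec_tac => v; have [k kE] := b_surj (~` b v.1)%O.
    by exists k; rewrite complP kE.
- split; first exact: can_inj hK.
  apply/seteqP; split => [_ [y _ <-]|n /ballbP Un] /=.
    apply/ballbP => m my; rewrite !lecE hK -eq_le; apply/negP => by_.
    by have [_ /(_ m by_)] := muP (h_ex y); rewrite leqNgt my.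
  exists (b n) => //; have [/eqP e] := muP (h_ex (b n)); rewrite -/(h (b n)) in e *.
  move=> /(_ n (eqxx _)); rewrite leq_eqVlt => /predU1P[//|/Un].
  by rewrite !lecE e lexx.
- by move=> x y; congr mu; apply/funext => k; rewrite meetP !hK.
- by move=> x y; congr mu; apply/funext => k; rewrite joinP !hK.
- by move=> x; congr mu; apply/funext => k; rewrite complP !hK.
Qed.

End decidable_copy.

(** * Clopen sets as finite unions of balls *)

Section clopen_codes.
Variables (R : realType) (M : metricType R) (a : nat -> M).
Hypotheses (cM : compact [set: M]) (da : dense (range a)).

(** By compactness a clopen set has positive distance from its complement; the numerator 2 leaves
    room for two balls of radius 1/(c+1). *)
Lemma clopen_separation (K : set M) : clopen K ->
  exists c : nat, forall x y, K x -> ~ K y -> 2 / c.+1%:R < mdist x y.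
Proof.
move=> [oK cK].
pose P c (x : M) := forall y, K x -> ~ K y -> 2 / c.+1%:R < mdist x y.
have /compact_near_coveringP/(_ _ \oo P) := cM.
move=> /(_ _ _)[x _|N _ /(_ N (leqnn N)) hN]; last by exists N => x y; exact: hN.
have [Kx|nKx] := pselect (K x); last first.
  have h : nbhs x (~` K) by apply: open_nbhs_nbhs; split => //; exact: closed_openC.
  exists (~` K, setT); first by split => //; exact: filterT.
  by move=> [z n] [/= nKz _] y.
have : nbhs x K by exact: open_nbhs_nbhs.
rewrite -nbhs_ballE => -[e /= e0 eK].
exists (ball x (e / 2), [set c | (Num.truncn (4 / e) <= c)%N]).
  split; last by exists (Num.truncn (4 / e)).
  by apply: nbhsx_ballx; rewrite divr_gt0.
move=> [z c] [/= xz ec] y Kz nKy.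
have : ~ ball x e y by move=> /eK.
move: xz; rewrite !ballEmdist /= => xz /negP; rewrite -leNgt => exy.
have := metric_triangle x z y.
have : 2 / c.+1%:R < e / 2.
  rewrite ltr_pdivrMr ?ltr0n// -ltr_pdivrMl ?divr_gt0//.
  have := truncnS_gt (4 / e); rewrite -(ler_nat R) in ec.
  have -> : (e / 2)^-1 * 2 = 4 / e by field; rewrite gt_eqF.
  by move=> h; apply: lt_le_trans h _; rewrite ler_nat ltnS -(ler_nat R).
move=> ce tri; apply: lt_le_trans ce _; lra.
Qed.

Lemma finite_net (r : R) : 0 < r ->
  exists N, forall x, exists2 i, (i < N)%N & mdist x (a i) < r.
Proof.
move=> r0; pose P N (x : M) := exists2 i, (i < N)%N & mdist x (a i) < r.
have /compact_near_coveringP/(_ _ \oo P) := cM.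
move=> /(_ _ _)[x _|N _ /(_ N (leqnn N)) hN]; last by exists N => x; exact: hN.
have [y [+ [i _ iy]]] : (ball x (r / 2))^° `&` range a !=set0.
  apply: da; last exact: open_interior.
  by exists x; apply: nbhsx_ballx; rewrite divr_gt0.
rewrite -{y}iy => xi.
exists (ball x (r / 2), [set N | (i < N)%N]).
  by split; [apply: nbhsx_ballx; rewrite divr_gt0 | exists i.+1].
move=> [z N] [/= xz iN]; exists i => //.
move: xz (interior_subset xi); rewrite !ballEmdist /= => xz xi'.
have := metric_triangle z x (a i); rewrite (metric_sym z x); lra.
Qed.

Definition cov (E : nat) : set M :=
  [set x | exists2 w, w \in CodeSeq.decode E &
    mdist x (a (ball_of_code w).1) < ratr (ball_of_code w).2].

Lemma cover_codesE E : cover_codes a E <-> cov E = setT.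
Proof.
split=> [h|h x].
  apply/seteqP; split => // x _; have [c /mapP[w wE ->] lt] := h x.
  by exists w.
have [w wE lt] : cov E x by rewrite h.
by exists (ball_of_code w) => //; exact: map_f.
Qed.

Lemma cov_open E : open (cov E).
Proof.
rewrite openE => x [w wE lt]; rewrite /interior -nbhs_ballE.
exists (ratr (ball_of_code w).2 - mdist x (a (ball_of_code w).1)).
  by rewrite /= subr_gt0.
move=> y; rewrite ballEmdist /= => xy; exists w => //.
move: xy; move: (ratr _ : R) => r xy.
have := metric_triangle y x (a (ball_of_code w).1); rewrite (metric_sym y x); lra.
Qed.

Lemma cov_sub E F : {subset CodeSeq.decode E <= CodeSeq.decode F} -> cov E `<=` cov F.
Proof. by move=> EF x [w /EF wF lt]; exists w. Qed.

(** Balls of radius 1/(c+1) around a finite net are sorted by the side on which their centres lie.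
    The separation keeps each ball on its side and makes balls from opposite sides formally
    disjoint: the radii add up to less than the distance of the centres, which approximations can
    confirm. *)
Lemma clopen_codes (K : set M) : clopen K -> exists E F,
  [/\ cov E = K, cov F = ~` K & forall w w', w \in CodeSeq.decode E ->
    w' \in CodeSeq.decode F -> ratr (ball_of_code w).2 + ratr (ball_of_code w').2 <
      mdist (a (ball_of_code w).1) (a (ball_of_code w').1)].
Proof.
move=> clK; have [c csep] := clopen_separation clK.
have [r [r0 rE sep]] : exists r : R, [/\ 0 < r, ratr (1 / c.+1%:R) = r
    & forall x y, K x -> ~ K y -> 2 * r < mdist x y].
  exists c.+1%:R^-1; split; [by rewrite invr_gt0 ltr0n | | exact: csep].
  by rewrite div1r fmorphV /= ratr_nat.
have [N net] := finite_net r0.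
have /choice[w wE] : forall i, exists w, ball_of_code w = (i, 1 / c.+1%:R).
  move=> i; have [w wE] := decode_onto [:: i; 1; 0; c]%N.
  by exists w; rewrite /ball_of_code wE /= subr0.
have listP (P : nat -> bool) : exists E, forall v, v \in CodeSeq.decode E <->
    exists i, [/\ (i < N)%N, P i & v = w i].
  have [E EE] := decode_onto [seq w i | i <- iota 0 N & P i]; exists E => v.
  rewrite EE; split => [/mapP[i]|[i [iN Pi ->]]].
    by rewrite mem_filter mem_iota => /andP[Pi iN] ->; exists i.
  by apply/mapP; exists i => //; rewrite mem_filter mem_iota Pi.
have [E EP] := listP (fun i => `[< K (a i) >]).
have [F FP] := listP (fun i => `[< ~ K (a i) >]).
exists E, F; split.
- apply/seteqP; split => [x [_ /EP[i [iN /asboolP Ki ->]]]|x Kx].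
    rewrite wE /= rE => lt; apply: contrapT => nKx.
    have := sep _ _ Ki nKx; rewrite metric_sym; lra.
  have [i iN lt] := net x; exists (w i); last by rewrite wE /= rE.
  apply/EP; exists i; split => //; apply/asboolP; apply: contrapT => nKi.
  have := sep _ _ Kx nKi; lra.
- apply/seteqP; split => [x [_ /FP[i [iN /asboolP nKi ->]]]|x nKx].
    rewrite wE /= rE => lt Kx.
    have := sep _ _ Kx nKi; lra.
  have [i iN lt] := net x; exists (w i); last by rewrite wE /= rE.
  apply/FP; exists i; split => //; apply/asboolP => Ki.
  have := sep _ _ Ki nKx; rewrite metric_sym; lra.
- move=> _ _ /EP[i [_ /asboolP Ki ->]] /FP[j [_ /asboolP nKj ->]].
  rewrite !wE /= rE; have := sep _ _ Ki nKj; lra.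
Qed.

End clopen_codes.

(** * Deciding inclusions between coded clopen sets *)

Lemma eventually_all (T : eqType) (s : seq T) (P : T -> nat -> Prop) :
  (forall x, x \in s -> exists N, forall t, (N <= t)%N -> P x t) ->
  exists N, forall t, (N <= t)%N -> forall x, x \in s -> P x t.
Proof.
elim: s => [|y s IH] h; first by exists 0%N.
have [N hN] := IH (fun x xs => h x (mem_behead (s := y :: s) xs)).
have [N' hN'] := h y (mem_head _ _).
exists (maxn N N') => t; rewrite geq_max => /andP[Nt N't] x.
by rewrite inE => /predU1P[->|]; [exact: hN' | exact: hN].
Qed.

(** Clearing denominators and moving subtracted terms across turns a comparison of rationals into
    one of natural numbers, which is visibly recursive. *)
Lemma approx_lt_nat (R : realType) (P Q S p q c t : nat) :
  (P * c.+1 * 2 ^ t + S.+1 * c.+1 + q * S.+1 * 2 ^ t <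
   p * S.+1 * 2 ^ t + Q * c.+1 * 2 ^ t)%N =
  ((P%:R - Q%:R) / S.+1%:R + 2^-1 ^+ t < (p%:R - q%:R) / c.+1%:R :> R).
Proof.
rewrite -(ltr_nat R) !natrD !natrM natrX.
have : 0 < S.+1%:R :> R by rewrite ltr0n.
have : 0 < c.+1%:R :> R by rewrite ltr0n.
have : 0 < 2 ^+ t :> R by rewrite exprn_gt0.
rewrite exprVn; move: (S.+1%:R) (c.+1%:R) (2 ^+ t) => s' c' t' t0 c0 s0.
rewrite -subr_gt0 -[RHS]subr_gt0.
rewrite -[RHS](pmulr_lgt0 _ (mulr_gt0 (mulr_gt0 s0 c0) t0)); congr (0 < _).
by field; rewrite !gt_eqF.
Qed.

Lemma approx_gt_nat (R : realType) (P Q S p q c p' q' c' t : nat) :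
  (p * c'.+1 * S.+1 * 2 ^ t + p' * c.+1 * S.+1 * 2 ^ t + c.+1 * c'.+1 * S.+1 +
     Q * c.+1 * c'.+1 * 2 ^ t <
   P * c.+1 * c'.+1 * 2 ^ t + q * c'.+1 * S.+1 * 2 ^ t + q' * c.+1 * S.+1 * 2 ^ t)%N =
  ((p%:R - q%:R) / c.+1%:R + (p'%:R - q'%:R) / c'.+1%:R + 2^-1 ^+ t <
   (P%:R - Q%:R) / S.+1%:R :> R).
Proof.
rewrite -(ltr_nat R) !natrD !natrM natrX.
have : 0 < S.+1%:R :> R by rewrite ltr0n.
have : 0 < c.+1%:R :> R by rewrite ltr0n.
have : 0 < c'.+1%:R :> R by rewrite ltr0n.
have : 0 < 2 ^+ t :> R by rewrite exprn_gt0.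
rewrite exprVn; move: (S.+1%:R) (c.+1%:R) (c'.+1%:R) (2 ^+ t) => s d d' e e0 d'0 d0 s0.
rewrite -subr_gt0 -[RHS]subr_gt0.
rewrite -[RHS](pmulr_lgt0 _ (mulr_gt0 (mulr_gt0 (mulr_gt0 s0 d0) d'0) e0)).
by congr (0 < _); field; rewrite !gt_eqF.
Qed.

Section copy_of_presentation.
Variables (R : realType) (M : metricType R) (a : nat -> M) (A : nat -> bool).
Hypotheses (cM : compact [set: M]) (da : dense (range a)).
Variables pp qq ss : nat -> nat -> nat -> nat.
Hypothesis hpp : Rec A (fun v : ctx 3 => pp v.1 v.2.1 v.2.2.1).
Hypothesis hqq : Rec A (fun v : ctx 3 => qq v.1 v.2.1 v.2.2.1).
Hypothesis hss : Rec A (fun v : ctx 3 => ss v.1 v.2.1 v.2.2.1).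

Let approx i j t : R := ((pp i j t)%:R - (qq i j t)%:R) / (ss i j t).+1%:R.

Hypothesis approxP : forall i j t, `| mdist (a i) (a j) - approx i j t | <= 2^-1 ^+ t.

Variable f : nat -> nat.
Hypothesis hf : Rec A (fun v : ctx 1 => f v.1).
Hypothesis fE : cover_codes a = range f.

Context {disp : Order.disp_t} {B : ctbDistrLatticeType disp}.
Variable phi : B -> set M.
Hypothesis dphi : stone_dual phi.

Let ctr w := (ball_of_code w).1.
Let rad w : R := ratr (ball_of_code w).2.

Let ctrE w : ctr w = nthc w 0.
Proof. by rewrite /ctr ball_of_codeE. Qed.

Let radE w : rad w = ((nthc w 1)%:R - (nthc w 2)%:R) / (nthc w 3).+1%:R.
Proof.
by rewrite /rad ball_of_codeE /= rmorphM /= fmorphV /= rmorphB /= !ratr_nat.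
Qed.

Let approx_close i j (e : R) : 0 < e -> exists N, forall t, (N <= t)%N ->
  2^-1 ^+ t < e /\
  approx i j t - 2^-1 ^+ t <= mdist (a i) (a j) <= approx i j t + 2^-1 ^+ t.
Proof.
move=> e0; have [N Ne] := half_exp_lt e0; exists N => t Nt; split.
  by apply: le_lt_trans Ne; rewrite half_exp_le.
by have := approxP i j t; rewrite ler_distl.
Qed.

Let in_ball t i w :=
  (pp i (nthc w 0) t * (nthc w 3).+1 * 2 ^ t + (ss i (nthc w 0) t).+1 * (nthc w 3).+1 +
     nthc w 2 * (ss i (nthc w 0) t).+1 * 2 ^ t <
   nthc w 1 * (ss i (nthc w 0) t).+1 * 2 ^ t +
     qq i (nthc w 0) t * (nthc w 3).+1 * 2 ^ t)%N.

Let Rec_in_ball : Rec A (fun v : ctx 3 => nat_of_bool (in_ball v.1 v.2.1 v.2.2.1)).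
Proof. by rewrite /in_ball; rec_tac. Qed.

Let in_ballE t i w : in_ball t i w = (approx i (ctr w) t + 2^-1 ^+ t < rad w).
Proof. by rewrite /in_ball (approx_lt_nat R) radE ctrE. Qed.

Let in_ball_sound t i w : in_ball t i w -> mdist (a i) (a (ctr w)) < rad w.
Proof.
rewrite in_ballE; apply: le_lt_trans.
by have := approxP i (ctr w) t; rewrite ler_distl => /andP[].
Qed.

Let in_ball_complete i w : mdist (a i) (a (ctr w)) < rad w ->
  exists N, forall t, (N <= t)%N -> in_ball t i w.
Proof.
rewrite -subr_gt0 => h.
(* Half of the gap, because the error enters twice: in the approximation and in the margin of the
   test. *)
have [N hN] := approx_close i (ctr w) (divr_gt0 h (ltr0n R 2)).
exists N => t /hN[]; rewrite in_ballE.
move: (rad w) (mdist _ _) (approx _ _ _) (2^-1 ^+ t) => r m p e; lra.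
Qed.

Let far t w w' :=
  let i := nthc w 0 in let j := nthc w' 0 in
  (nthc w 1 * (nthc w' 3).+1 * (ss i j t).+1 * 2 ^ t +
   nthc w' 1 * (nthc w 3).+1 * (ss i j t).+1 * 2 ^ t +
   (nthc w 3).+1 * (nthc w' 3).+1 * (ss i j t).+1 +
   qq i j t * (nthc w 3).+1 * (nthc w' 3).+1 * 2 ^ t <
   pp i j t * (nthc w 3).+1 * (nthc w' 3).+1 * 2 ^ t +
   nthc w 2 * (nthc w' 3).+1 * (ss i j t).+1 * 2 ^ t +
   nthc w' 2 * (nthc w 3).+1 * (ss i j t).+1 * 2 ^ t)%N.

Let Rec_far : Rec A (fun v : ctx 3 => nat_of_bool (far v.1 v.2.1 v.2.2.1)).
Proof. by rewrite /far; cbv zeta; rec_tac. Qed.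

Let farE t w w' : far t w w' =
  (rad w + rad w' + 2^-1 ^+ t < approx (ctr w) (ctr w') t).
Proof. by rewrite /far (approx_gt_nat R) !radE !ctrE. Qed.

Let far_sound t w w' : far t w w' -> rad w + rad w' < mdist (a (ctr w)) (a (ctr w')).
Proof.
rewrite farE -ltrBrDr => /lt_le_trans; apply.
by have := approxP (ctr w) (ctr w') t; rewrite ler_distl => /andP[].
Qed.

Let far_complete w w' : rad w + rad w' < mdist (a (ctr w)) (a (ctr w')) ->
  exists N, forall t, (N <= t)%N -> far t w w'.
Proof.
rewrite -subr_gt0 => h.
have [N hN] := approx_close (ctr w) (ctr w') (divr_gt0 h (ltr0n R 2)).
exists N => t /hN[]; rewrite farE.
move: (rad w) (rad w') (mdist _ _) (approx _ _ _) (2^-1 ^+ t) => r r' m p e; lra.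
Qed.

Let memc w E := bexb (sizec E) (fun m => nthc E m == w).

Let Rec_memc : Rec A (fun v : ctx 2 => nat_of_bool (memc v.1 v.2.1)).
Proof. by rewrite /memc; rec_tac. Qed.

Let memcE w E : memc w E = (w \in CodeSeq.decode E).
Proof.
apply/bexbP/(nthP 0%N) => -[m]; first by rewrite sizecE nthcE => mE /eqP; exists m.
by move=> mE <-; exists m; rewrite ?sizecE// nthcE.
Qed.

Let cov_all E : cov a E = setT <-> exists n, f n = E.
Proof.
rewrite -cover_codesE; split => [|[n nE]]; first by rewrite fE => -[n _ nE]; exists n.
by rewrite fE; exists n.
Qed.

Let allc E (P : nat -> bool) := ballb (sizec E) (fun m => P (nthc E m)).

Let allcP E (P : nat -> bool) :
  reflect (forall w, w \in CodeSeq.decode E -> P w) (allc E P).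
Proof.
apply: (iffP (ballbP _ _)) => [h w /(nthP 0%N)[m mE <-]|h m mE].
  by rewrite -nthcE; apply: h; rewrite sizecE.
by apply: h; rewrite nthcE mem_nth// -sizecE.
Qed.

(* A number [c] codes the list of the codes [E], [F] of the balls of a clopen set
   and of its complement, a precision at which they are seen to be disjoint, and a
   stage at which they are seen to cover. *)
Let valid c :=
  allc (f (nthc c 3)) (fun w => memc w (nthc c 0) || memc w (nthc c 1)) &&
  allc (nthc c 0) (fun w => allc (nthc c 1) (far (nthc c 2) w)).

Let Rec_valid : Rec A (fun v : ctx 1 => nat_of_bool (valid v.1)).
Proof. by rewrite /valid /allc; rec_tac. Qed.

(** An invalid number stands for the empty set: 0 codes the empty list, and [f 0] a cover of the
    whole space. Every number thus names a clopen set together with its complement. *)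
Let inc c := if valid c then nthc c 0 else 0%N.
Let outc c := if valid c then nthc c 1 else f 0.

Let Rec_inc : Rec A (fun v : ctx 1 => inc v.1).
Proof. by rewrite /inc; rec_tac. Qed.

Let Rec_outc : Rec A (fun v : ctx 1 => outc v.1).
Proof. by rewrite /outc; rec_tac. Qed.

Let outcE c : cov a (outc c) = ~` cov a (inc c).
Proof.
rewrite /outc /inc; case: ifP => [/andP[/allcP h1 /allcP h2]|_].
  apply/seteqP; split => x.
    move=> [w' w'F wx] [w wE wx'].
    have /allcP/(_ w' w'F)/far_sound := h2 w wE.
    rewrite -/(ctr w') -/(rad w') in wx; rewrite -/(ctr w) -/(rad w) in wx'.
    have := metric_triangle (a (ctr w)) x (a (ctr w')); rewrite metric_sym.
    move: wx wx'; move: (rad w) (rad w').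
    rewrite (metric_sym (a (ctr w)) x) => r r'; lra.
  move=> nx; have [w wf wx] : cov a (f (nthc c 3)) x.
    by have [_ ->] := cov_all (f (nthc c 3)) => //; exists (nthc c 3).
  have /orP[] := h1 _ wf; rewrite memcE => wE; last by exists w.
  by case: nx; exists w.
have [_ ->] := cov_all (f 0); last by exists 0%N.
rewrite -setC0; congr setC; apply/seteqP; split => // x [w].
by rewrite (_ : CodeSeq.decode 0 = [::]).
Qed.

Let inc_clopen c : clopen (cov a (inc c)).
Proof.
split; first exact: cov_open.
by rewrite -[cov a (inc c)]setCK -outcE; apply: open_closedC; exact: cov_open.
Qed.

(** The two lists of [clopen_codes] concatenate to a cover, which [f] lists at some stage; finitely
    many pairs of balls share one precision at which they are seen to be disjoint. *)
Let inc_onto K : clopen K -> exists c, cov a (inc c) = K.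
Proof.
move=> clK; have [E [F [EK FK sep]]] := clopen_codes cM da clK.
have [G GE] := decode_onto (CodeSeq.decode E ++ CodeSeq.decode F).
have [s sG] : exists s, f s = G.
  apply/cov_all; rewrite (_ : setT = cov a E `|` cov a F); last by rewrite EK FK setUv.
  apply/seteqP; split => x.
    by move=> [w]; rewrite GE mem_cat => /orP[wE|wF] wx; [left|right]; exists w.
  by move=> [[w wE wx]|[w wF wx]]; exists w => //; rewrite GE mem_cat ?wE ?wF ?orbT.
have [t ht] : exists t, forall w, w \in CodeSeq.decode E ->
    forall w', w' \in CodeSeq.decode F -> far t w w'.
  have [N hN] : exists N, forall t, (N <= t)%N -> forall w, w \in CodeSeq.decode E ->
      forall w', w' \in CodeSeq.decode F -> far t w w'.
    apply: eventually_all => w wE; apply: eventually_all => w' w'F.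
    exact/far_complete/sep.
  by exists N; exact: hN.
have [c cE] := decode_onto [:: E; F; t; s]; exists c.
have c0 : nthc c 0 = E by rewrite nthcE cE.
have c1 : nthc c 1 = F by rewrite nthcE cE.
have c2 : nthc c 2 = t by rewrite nthcE cE.
have c3 : nthc c 3 = s by rewrite nthcE cE.
rewrite /inc (_ : valid c) ?c0//; rewrite /valid c0 c1 c2 c3 sG; apply/andP; split.
  by apply/allcP => w; rewrite GE mem_cat !memcE.
by apply/allcP => w wE; apply/allcP => w' w'F; exact: ht.
Qed.

(** The inclusion holds exactly when the complements on the left and the sets on the right cover the
    space; stage [n] shows a cover built from their balls only. *)
Let yes n i l j k := allc (f n) (fun w =>
  [|| memc w (outc i), memc w (outc l), memc w (inc j) | memc w (inc k)]).

Let seen n E := bexb (sizec E) (fun m => in_ball (nthc n 1) (nthc n 0) (nthc E m)).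

Let Rec_seen : Rec A (fun v : ctx 2 => nat_of_bool (seen v.1 v.2.1)).
Proof. by rewrite /seen; rec_tac. Qed.

Let no n i l j k :=
  [&& seen n (inc i), seen n (inc l), seen n (outc j) & seen n (outc k)].

Let seen_sound n E : seen n E -> cov a E (a (nthc n 0)).
Proof.
move=> /bexbP[m mE /in_ball_sound h]; exists (nthc E m) => //.
by rewrite nthcE mem_nth// -sizecE.
Qed.

Let seen_complete p E : cov a E (a p) ->
  exists N, forall t, (N <= t)%N -> forall n, CodeSeq.decode n = [:: p; t] -> seen n E.
Proof.
move=> [w /(nthP 0%N)[m mE mw] /in_ball_complete[N hN]]; exists N => t Nt n nE.
apply/bexbP; exists m; first by rewrite sizecE.
by rewrite !nthcE nE mw; exact: hN.
Qed.

Let below i l j k :=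
  cov a (inc i) `&` cov a (inc l) `<=` cov a (inc j) `|` cov a (inc k).

Let yes_sound n i l j k : yes n i l j k -> below i l j k.
Proof.
move=> /allcP h x [xi xl].
have [w /h wf wx] : cov a (f n) x by have [_ ->] := cov_all (f n) => //; exists n.
move: wf; rewrite !memcE => /or4P[] wE.
- by have : cov a (outc i) x by [exists w]; rewrite outcE.
- by have : cov a (outc l) x by [exists w]; rewrite outcE.
- by left; exists w.
- by right; exists w.
Qed.

Let no_sound n i l j k : no n i l j k -> ~ below i l j k.
Proof.
move=> /and4P[/seen_sound ni /seen_sound nl]; move=> /seen_sound + /seen_sound.
by rewrite !outcE => nj nk /(_ _ (conj ni nl))[].
Qed.

Let yes_or_no i l j k : exists n, yes n i l j k || no n i l j k.
Proof.
have [h|/existsNP[x /not_implyP[[xi xl] /not_orP[xj xk]]]] := pselect (below i l j k).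
  have [G GE] := decode_onto (CodeSeq.decode (outc i) ++ CodeSeq.decode (outc l) ++
    CodeSeq.decode (inc j) ++ CodeSeq.decode (inc k)).
  have [n nG] : exists n, f n = G.
    apply/cov_all/seteqP; split => // x _.
    have sub E : {subset CodeSeq.decode E <= CodeSeq.decode G} ->
        cov a E x -> cov a G x.
      by move=> /cov_sub; apply.
    have [xi|nxi] := pselect (cov a (inc i) x); last first.
      by apply: (sub (outc i)); [move=> w; rewrite GE !mem_cat => ->|rewrite outcE].
    have [xl|nxl] := pselect (cov a (inc l) x); last first.
      apply: (sub (outc l)); last by rewrite outcE.
      by move=> w; rewrite GE !mem_cat => ->; rewrite !orbT.
    have [xj|xk] := h x (conj xi xl).
      by apply: (sub (inc j)) => // w; rewrite GE !mem_cat => ->; rewrite !orbT.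
    by apply: (sub (inc k)) => // w; rewrite GE !mem_cat => ->; rewrite !orbT.
  exists n; apply/orP; left; apply/allcP => w.
  by rewrite nG GE !mem_cat !memcE.
(* The set of counterexamples is open because complements are unions of balls too, so it contains a
   point of the dense sequence. *)
have [y [[[yi yl] [yj yk]] [p _ py]]] : ((cov a (inc i) `&` cov a (inc l)) `&`
    (cov a (outc j) `&` cov a (outc k))) `&` range a !=set0.
  apply: da; first by exists x; rewrite !outcE.
  by do 2! apply: openI; exact: cov_open.
rewrite -{y}py in yi yl yj yk.
have [N1 h1] := seen_complete yi; have [N2 h2] := seen_complete yl.
have [N3 h3] := seen_complete yj; have [N4 h4] := seen_complete yk.
(* Each membership is confirmed at all sufficiently high precisions, so the maximum serves for the
   four at once. *)
have [n nE] := decode_onto [:: p; maxn (maxn N1 N2) (maxn N3 N4)].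
exists n; apply/orP; right; apply/and4P; split.
- by apply: h1 nE; rewrite !leq_max leqnn.
- by apply: h2 nE; rewrite !leq_max leqnn !orbT.
- by apply: h3 nE; rewrite !leq_max leqnn !orbT.
- by apply: h4 nE; rewrite !leq_max leqnn !orbT.
Qed.

Let decide i l j k := yes (mu (fun n => yes n i l j k || no n i l j k)) i l j k.

Let decideP i l j k : decide i l j k <-> below i l j k.
Proof.
split; first exact: yes_sound.
by have [/orP[//|/no_sound]] := muP (yes_or_no i l j k).
Qed.

Let Rec_decide :
  Rec A (fun v : ctx 4 => nat_of_bool (decide v.1 v.2.1 v.2.2.1 v.2.2.2.1)).
Proof.
pose g i l j k := mu (fun n => yes n i l j k || no n i l j k).
have hg : Rec A (fun v : ctx 4 => g v.1 v.2.1 v.2.2.1 v.2.2.2.1).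
  by rewrite /g /yes /no /allc; rec_tac => v; exact: yes_or_no.
change (Rec A (fun v : ctx 4 => nat_of_bool
  (yes (g v.1 v.2.1 v.2.2.1 v.2.2.2.1) v.1 v.2.1 v.2.2.1 v.2.2.2.1))).
rewrite /yes /allc.
by rec_tac.
Qed.

Lemma copy_of_covers (d : turing_degree) :
  (forall n (g : n.-tuple nat -> nat), recursive_in A g -> computable d g) ->
  has_computable_copy B d.
Proof.
have /choice[b bE] : forall c, exists y, phi y = cov a (inc c).
  by move=> c; exact: (dual_surj dphi (inc_clopen c)).
apply: (@copy_of_decidable A _ B b decide) => // [y|i l j k].
  have [c cE] := inc_onto (dual_clopen dphi y).
  by exists c; apply: (dual_inj dphi); rewrite bE.
apply/idP/idP => [/decideP h|/(dual_le dphi) h].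
  by apply/(dual_le dphi); rewrite (dualI dphi) (dualU dphi) !bE.
by apply/decideP; move: h; rewrite (dualI dphi) (dualU dphi) !bE.
Qed.

End copy_of_presentation.

(** * Transport to the completion that presents the space *)

Lemma dual_transport disp (B : ctbDistrLatticeType disp) (X Y : topologicalType)
    (phi : B -> set X) (f : Y -> X) (g : X -> Y) :
  cancel f g -> cancel g f -> continuous f -> continuous g ->
  stone_dual phi -> stone_dual (fun y => f @^-1` phi y).
Proof.
move=> fg gf cf cg dphi; split.
- by move=> y; apply: preimage_clopen => //; exact: dual_clopen.
- move=> y z yz; apply: (dual_inj dphi); apply/seteqP; split => x.
    by rewrite -[x]gf -[phi y _]/((f @^-1` phi y) _) yz.
  by rewrite -[x]gf -[phi z _]/((f @^-1` phi z) _) -yz.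
- move=> K clK; have [y yE] := dual_surj dphi (preimage_clopen clK cg).
  by exists y; rewrite yE; apply/seteqP; split => x /=; rewrite fg.
- by move=> y z; rewrite (dualI dphi).
- by move=> y; rewrite (dualC dphi).
Qed.

Lemma homeomorphic_compact (X Y : topologicalType) :
  homeomorphic Y X -> compact [set: X] -> compact [set: Y].
Proof.
move=> [f [g [fg gf cf cg]]] cX.
have -> : [set: Y] = g @` setT by apply/seteqP; split => // y _; exists (f y).
by apply: continuous_compact => //; exact: continuous_subspaceT.
Qed.

Lemma copy_of_presentation (R : realType) disp (B : ctbDistrLatticeType disp)
    (X : topologicalType) (phi : B -> set X) (d : turing_degree) :
  stone_dual phi -> compact [set: X] ->
  has_computable_compact_presentation R X d -> has_computable_copy B d.
Proof.
move=> dphi cX [rho [M [a [[_ _ [_ da rhoE] hM] [p [q [s [hp hq hs pqs]]]] ce]]]].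
have cM := homeomorphic_compact hM cX; have [f [g [fg gf cf cg]]] := hM.
have [A hA] := degree_oracle d.
move: hp hq hs => /hA/Rec_ternary hp /hA/Rec_ternary hq /hA/Rec_ternary hs.
have [u hu uE] :
    exists2 u : nat -> nat, computable d (unary u) & cover_codes a = range u.
  (* The set of cover codes is not empty, since the whole space is clopen and so is a finite union
     of rational balls. *)
  case: ce => // e0; have [E [_ [ET _ _]]] := clopen_codes cM da clopenT.
  by have : cover_codes a E by [apply/cover_codesE]; rewrite e0.
move: hu => /hA/Rec_unary hu.
apply: (@copy_of_covers R M a A cM da (fun i j t => p [tuple i; j; t])
  (fun i j t => q [tuple i; j; t]) (fun i j t => s [tuple i; j; t]) hp hq hs _ u hu uE
  disp B _ (dual_transport fg gf cf cg dphi)).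
- by move=> i j t; rewrite rhoE; exact: pqs.
- by move=> n h; move/hA.
Qed.

(** * The algebra of clopen sets *)

Definition clopen_set (X : topologicalType) : Type := {K : set X | clopen K}.

HB.instance Definition _ X := gen_eqMixin (clopen_set X).
HB.instance Definition _ X := gen_choiceMixin (clopen_set X).

Section clopen_algebra.
Variable X : topologicalType.
Implicit Types K L : clopen_set X.

Definition cl_meet K L : clopen_set X :=
  exist _ (sval K `&` sval L) (clopenI (svalP K) (svalP L)).
Definition cl_join K L : clopen_set X :=
  exist _ (sval K `|` sval L) (clopenU (svalP K) (svalP L)).
Definition cl_compl K : clopen_set X :=
  exist _ (~` sval K) (clopenC set0 (svalP K)).
Definition cl_bot : clopen_set X := exist _ set0 clopen0.
Definition cl_top : clopen_set X := exist _ setT clopenT.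

Lemma clopen_set_eq K L : sval K = sval L -> K = L.
Proof. by move: K L => [K cK] [L cL] /= e; exact: eq_exist. Qed.

Lemma cl_meetC : commutative cl_meet.
Proof. by move=> K L; apply: clopen_set_eq; exact: setIC. Qed.
Lemma cl_joinC : commutative cl_join.
Proof. by move=> K L; apply: clopen_set_eq; exact: setUC. Qed.
Lemma cl_meetA : associative cl_meet.
Proof. by move=> K L J; apply: clopen_set_eq; exact: setIA. Qed.
Lemma cl_joinA : associative cl_join.
Proof. by move=> K L J; apply: clopen_set_eq; exact: setUA. Qed.
Lemma cl_joinKI L K : cl_meet K (cl_join K L) = K.
Proof. by apply: clopen_set_eq; rewrite /= setUC setKU. Qed.
Lemma cl_meetKU L K : cl_join K (cl_meet K L) = K.
Proof. by apply: clopen_set_eq; rewrite /= setIC setKI. Qed.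
Lemma cl_meetUl : left_distributive cl_meet cl_join.
Proof. by move=> K L J; apply: clopen_set_eq; exact: setIUl. Qed.
Lemma cl_meetxx : idempotent_op cl_meet.
Proof. by move=> K; apply: clopen_set_eq; exact: setIid. Qed.

HB.instance Definition _ := Order.isMeetJoinDistrLattice.Build set_display
  (clopen_set X) (le := fun K L => cl_meet K L == K)
  (lt := fun K L => (L != K) && (cl_meet K L == K)) (fun _ _ => erefl)
  (fun _ _ => erefl) cl_meetC cl_joinC cl_meetA cl_joinA cl_joinKI cl_meetKU
  cl_meetUl cl_meetxx.

Lemma cl_le0x K : (cl_bot <= K)%O.
Proof. by apply/eqP/clopen_set_eq; exact: set0I. Qed.
Lemma cl_lex1 K : (K <= cl_top)%O.
Proof. by apply/eqP/clopen_set_eq; exact: setIT. Qed.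

HB.instance Definition _ := Order.hasBottom.Build set_display (clopen_set X) cl_le0x.
HB.instance Definition _ := Order.hasTop.Build set_display (clopen_set X) cl_lex1.

Lemma cl_joinxC K : (K `|` cl_compl K)%O = \top%O.
Proof. by apply: clopen_set_eq; exact: setUv. Qed.
Lemma cl_meetxC K : (K `&` cl_compl K)%O = \bot%O.
Proof. by apply: clopen_set_eq; exact: setICr. Qed.

HB.instance Definition _ := Order.TBDistrLattice_hasComplement.Build set_display
  (clopen_set X) cl_joinxC cl_meetxC.

Lemma clopen_set_dual : stone_dual (fun K : clopen_set X => sval K).
Proof.
split=> //; first exact: svalP; first exact: clopen_set_eq.
by move=> K clK; exists (exist _ K clK).
Qed.

End clopen_algebra.

(** * Countability of the clopen algebra and equality of the spectra *)

Lemma clopen_set_countable (R : realType) (X : topologicalType) :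
  CP0 R X -> countable [set: clopen_set X].
Proof.
move=> [[x0 _] cX _ [[D cD dD] [M _ hM]]].
have cM := homeomorphic_compact hM cX; have [f [g [fg gf cf cg]]] := hM.
have [y0 [_ Dy0]] : setT `&` D !=set0 by apply: dD openT; exists x0.
have /countable_injP[i iI] := cD.
(* The countable dense set becomes a sequence in the metric copy, with [g y0] as default; relative
   to it each clopen set is the union of a coded list of balls, and that code determines the set. *)
have /choice[a aE] : forall n, exists x, forall y, D y -> i y = n -> x = g y.
  move=> n; have [[y [Dy yn]]|h] := pselect (exists y, D y /\ i y = n).
    exists (g y) => z Dz zn; congr g; apply: iI; rewrite ?inE//.
    by rewrite yn zn.
  by exists (g y0) => y Dy yn; case: h; exists y.
have da : dense (range a).
  move=> O [x Ox] oO.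
  have [y [Oy Dy]] : g @^-1` O `&` D !=set0.
    apply: dD; first by exists (f x); rewrite /= fg.
    by apply: open_comp oO => ? _; exact: cg.
  by exists (g y); split => //; exists (i y) => //; exact: aE.
have /choice[c cP] : forall K : clopen_set X, exists E, cov a E = f @^-1` (sval K).
  move=> K; have [E [_ [EK _ _]]] := clopen_codes cM da (preimage_clopen (svalP K) cf).
  by exists E.
apply/countable_injP; exists c => K L _ _ KL; apply: clopen_set_eq.
have e : f @^-1` (sval K) = f @^-1` (sval L) by rewrite -!cP KL.
apply/seteqP; split => x; rewrite -[x]gf => h.
  by have : (f @^-1` sval K) (g x) by []; rewrite e.
by have : (f @^-1` sval L) (g x) by []; rewrite -e.
Qed.

Lemma dual_spectrum (R : realType) disp (B : ctbDistrLatticeType disp)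
    (X : topologicalType) (phi : B -> set X) :
  stone_dual phi -> CP0 R X -> degree_spectrum B = compact_degree_spectrum R X.
Proof.
move=> dphi hX; apply/seteqP; split => d; first exact: (presentation_of_copy dphi hX).
by apply: (copy_of_presentation dphi); case: hX.
Qed.

Lemma countable_enum disp (B : ctbDistrLatticeType disp) :
  countable [set: B] -> exists b : nat -> B, forall y, exists n, b n = y.
Proof.
move=> /countable_injP[i iI].
have /choice[b bE] : forall n, exists x : B, forall y, i y = n -> x = y.
  move=> n; have [[y yn]|h] := pselect (exists y, i y = n).
    by exists y => z zn; apply: iI; rewrite ?inE// yn zn.
  by exists \bot%O => y yn; case: h; exists y.
by exists b => y; exists (i y); exact: bE.
Qed.

(** Parity enumerates [bool], and the inclusion relation is recursive in any oracle. *)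
Lemma bool_spectrum : degree_spectrum bool = setT.
Proof.
apply/seteqP; split => // d _; have [A hA] := degree_oracle d.
apply: (@copy_of_decidable A _ _ odd
  (fun i l j k => (odd i && odd l) ==> (odd j || odd k))).
- by case; [exists 1%N | exists 0%N].
- by rec_tac.
- by move=> i l j k; do 4! case: odd.
- by move=> n f /hA.
Qed.

Lemma trivial_spectrum disp (B : ctbDistrLatticeType disp) :
  (\top : B)%O = \bot%O -> degree_spectrum B = setT.
Proof.
move=> B0; have B1 (y : B) : y = \bot%O.
  by apply/eqP; rewrite -lex0 -B0 lex1.
apply/seteqP; split => // d _; have [A hA] := degree_oracle d.
apply: (@copy_of_decidable A _ B (fun=> \bot%O) (fun _ _ _ _ => true)).
- by move=> y; exists 0%N; rewrite (B1 y).
- by rec_tac.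
- by move=> i l j k; rewrite meetxx le0x.
- by move=> n f /hA.
Qed.

Theorem theorem2p9 (R : realType) : Sp_BA = Sp_c_CP0 R.
Proof.
have spec disp (B : ctbDistrLatticeType disp) : countable [set: B] ->
    (\top : B)%O != \bot%O -> exists X : topologicalType,
    CP0 R X /\ degree_spectrum B = compact_degree_spectrum R X.
  move=> /countable_enum[b b_surj] nt; exists (branch_space R b); split.
    exact: branch_CP0.
  by apply: dual_spectrum (branch_dual R b_surj) _; exact: branch_CP0.
apply/seteqP; split => S.
  move=> [disp [B [cB ->]]]; have [B0|nt] := eqVneq (\top : B)%O \bot%O.
    (* The dual of the one-element algebra is empty, hence not in the class; its spectrum, the set
       of all degrees, is realised by the dual of [bool] instead. *)
    rewrite trivial_spectrum// -bool_spectrum; apply: spec => //.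
    exact: countableP.
  exact: spec cB nt.
move=> [X [hX ->]]; exists set_display, (clopen_set X); split.
  exact: clopen_set_countable hX.
by rewrite (dual_spectrum (clopen_set_dual X) hX).
Qed.
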